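(* Let $u_l,u_r,\rho_l,\rho_r\in\mathbb{R}$ and, for $\epsilon>0$, consider the Riemann problem $$u_t+\Big(\frac{(u+\epsilon)^2}{2}\Big)_x=0,\quad \rho_t+(\rho u)_x=0,\quad (u,\rho)(x,0)=\begin{cases}(u_l,\rho_l), & x<0,\\ (u_r,\rho_r), & x>0.\end{cases}$$ (1) If $u_l<u_r$, then for every $\epsilon>0$ the problem has a unique weak solution $(u^\epsilon,\rho^\epsilon)$ (in the class of Lax Riemann solutions described in the context), and as $\epsilon\to0$ it converges in the sense of distributions on $\mathbb{R}\times(0,\infty)$ to $$u(x,t)=\begin{cases}u_l, & x<u_lt,\\ x/t, & u_lt<x<u_rt,\\ u_r, & x>u_rt,\end{cases}\qquad \rho(x,t)=\begin{cases}\rho_l, & x<u_lt,\\ 0, & u_lt<x<u_rt,\\ \rho_r, & x>u_rt.\end{cases}$$ (2) If $u_l\ge u_r$, then as $\epsilon\to0$ the solution $(u^\epsilon,\rho^\epsilon)$ of the problem (the Lax Riemann solution if $u_l=u_r$; the delta-wave solution, for $0<\epsilon<u_l-u_r$, if $u_l>u_r$; both described in the context) converges in the sense of distributions on $\mathbb{R}\times(0,\infty)$ to $$(u,\rho)(x,t)=\begin{cases}(u_l,\rho_l), & x<\frac{u_l+u_r}{2}t,\\ \Big(\frac{u_l+u_r}{2},\ \frac{(u_l-u_r)(\rho_l+\rho_r)}{2}\,t\,\delta_{x=\frac{u_l+u_r}{2}t}\Big), & x=\frac{u_l+u_r}{2}t,\\ (u_r,\rho_r), & x>\frac{u_l+u_r}{2}t,\end{cases}$$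 that is, $\rho=\rho_l\chi_{\{x<\frac{u_l+u_r}{2}t\}}+\rho_r\chi_{\{x>\frac{u_l+u_r}{2}t\}}+\frac{(u_l-u_r)(\rho_l+\rho_r)}{2}\,t\,\delta_{x=\frac{u_l+u_r}{2}t}$.
   Context: For a smooth curve $x=c(t)$, the weighted delta distribution $d(t)\delta_{x=c(t)}$ is defined by $\langle d(t)\delta_{x=c(t)},\varphi\rangle=\int_0^\infty d(t)\varphi(c(t),t)\,dt$ for $\varphi\in C_c^\infty(\mathbb{R}\times(0,\infty))$. The system $u_t+(\frac{(u+\epsilon)^2}{2})_x=0$, $\rho_t+(\rho u)_x=0$ has eigenvalues $\lambda_1=u$ (linearly degenerate, eigenvector $(0,1)$) and $\lambda_2=u+\epsilon$ (genuinely nonlinear, eigenvector $(1,\rho/\epsilon)$). Lax Riemann solution: a self-similar weak solution, i.e. a function of $x/t$, consisting of the left state $(u_l,\rho_l)$ joined by a (possibly trivial) 1-wave to a constant intermediate state, which is joined by a (possibly trivial) 2-wave to the right state $(u_r,\rho_r)$. A 1-wave is a contact discontinuity travelling with speed $\lambda_1=u$ between two states having the same value of $u$. A 2-wave is either a centered rarefaction wave (a continuous function of $\xi=x/t$ with $\lambda_2=\xi$ and $\frac{d}{d\xi}(u,\rho)=(1,\rho/\epsilon)$ in the wave fan) or a shock satisfying the Rankine-Hugoniot conditions with speed $s$ and the Lax conditions $\lambda_2(\text{right})<s<\lambda_2(\text{left})$, $s>\lambda_1(\text{left})$. Delta-wave solution (for $u_l>u_r$): a pair of the form $$u^\epsilon(x,t)=\begin{cases}u_l,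 & x<st,\\ u_\delta, & x=st,\\ u_r, & x>st,\end{cases}\qquad \rho^\epsilon=\rho_l\chi_{\{x<st\}}+\rho_r\chi_{\{x>st\}}+m(t)\,\delta_{x=st},$$ with constants $s,u_\delta\in\mathbb{R}$ and $m\in C^1([0,\infty))$, $m(0)=0$, which satisfies both equations of the system in the sense of distributions on $\mathbb{R}\times(0,\infty)$, where the product $\rho^\epsilon u^\epsilon$ is defined, using the value $u_\delta$ of $u^\epsilon$ on the discontinuity line, as $\rho_lu_l\chi_{\{x<st\}}+\rho_ru_r\chi_{\{x>st\}}+m(t)\,u_\delta\,\delta_{x=st}$. *)

(* Defs.v *)
(* MathComp-Analysis *)
From HB Require Import structures.
From mathcomp Require Import all_boot all_order all_algebra.
From mathcomp Require Import all_classical all_reals all_analysis.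
Set Implicit Arguments.
Unset Strict Implicit.
Unset Printing Implicit Defensive.
Import Order.TTheory GRing.Theory Num.Theory.
Import numFieldNormedType.Exports.
Local Open Scope classical_set_scope.
Local Open Scope ring_scope.

(* A point p = (x, t) of the space-time plane is a pair in R * R. *)

Section Distributions.
Context {R : realType}.
Implicit Types (f phi : R * R -> R) (p : R * R).

Definition half_plane : set (R * R) := [set p | 0 < p.2].

Definition lebesgue2 :
    {measure set (measurableTypeR R * measurableTypeR R) -> \bar R} :=
  (@lebesgue_measure R \x @lebesgue_measure R)%E.

Definition Dx f : R * R -> R := 'D_((1, 0) : R * R) f.
Definition Dt f : R * R -> R := 'D_((0, 1) : R * R) f.

Fixpoint differentiable_class (k : nat) f : Prop :=
  continuous f /\
  if k is k'.+1 then
    [/\ forall p, derivable f p (1, 0), forall p, derivable f p (0, 1),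
        differentiable_class k' (Dx f) & differentiable_class k' (Dt f)]
  else True.

Definition smooth f := forall k, differentiable_class k f.

Definition supp f : set (R * R) := closure [set p | f p != 0].

(* C_c^oo(R x (0, +oo)), each function being extended by 0 to the plane *)
Definition test_function phi :=
  [/\ smooth phi, compact (supp phi) & supp phi `<=` half_plane].

(* Only the values on test functions are meaningful, hence distr_eq below. *)
Definition distr := (R * R -> R) -> R.
Implicit Types S T : distr.

Definition distr_eq S T := forall phi, test_function phi -> S phi = T phi.

Definition regular_distr f : distr :=
  fun phi => \int[lebesgue2]_(p in half_plane) (f p * phi p).

Definition weighted_delta (d c : R -> R) : distr :=
  fun phi => \int[lebesgue_measure]_(t in `]0, +oo[) (d t * phi (c t, t)).

Definition loc_integrable f :=
  forall K : set (R * R), compact K -> K `<=` half_plane ->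
    lebesgue2.-integrable K (EFin \o f).

Definition ae_eq_half_plane f g :=
  {ae lebesgue2, forall p : R * R, half_plane p -> f p = g p}.

(* S_t + T_x = 0 in the sense of distributions on R x (0, +oo) *)
Definition conservation_law S T :=
  forall phi, test_function phi -> S (Dt phi) + T (Dx phi) = 0.

(* convergence in the sense of distributions as eps -> 0, eps > 0 *)
Definition distr_cvg (S : R -> distr) T :=
  forall phi, test_function phi -> S eps phi @[eps --> 0^'+] --> T phi.

(* left state a, right state b, and value c on the line x = s t *)
Definition step (s a c b : R) : R * R -> R :=
  fun p => if p.1 < s * p.2 then a else if p.1 == s * p.2 then c else b.

End Distributions.

Section System.
Context {R : realType}.
Variable eps : R.
(* A state is a pair w = (u, rho). *)
Implicit Types w wl wr : R * R.

Definition flux_u (u : R) : R := (u + eps) ^+ 2 / 2.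
Definition lambda1 w : R := w.1.
Definition lambda2 w : R := w.1 + eps.

Definition weak_solution (u rho : R * R -> R) :=
  [/\ loc_integrable u, loc_integrable (fun p => flux_u (u p)),
      loc_integrable rho & loc_integrable (fun p => rho p * u p)] /\
  conservation_law (regular_distr u) (regular_distr (fun p => flux_u (u p))) /\
  conservation_law (regular_distr rho) (regular_distr (fun p => rho p * u p)).

Definition initial_value (f : R * R -> R) (fl fr : R) :=
  (forall x : R, x < 0 -> f (x, t) @[t --> 0^'+] --> fl) /\
  (forall x : R, 0 < x -> f (x, t) @[t --> 0^'+] --> fr).

(* The jump from wl to wr travels with speed s; it is trivial if wl = wr. *)
Definition one_wave wl wr (s : R) :=
  wl.1 = wr.1 /\ s = lambda1 wl.

(* The 2-wave from wl to wr occupies a <= xi <= b, where xi = x / t and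
   the solution is xi |-> (U xi, P xi). *)
Inductive two_wave wl wr (U P : R -> R) (a b : R) : Prop :=
| TwoTrivial of wl = wr & a = b
| TwoRarefaction of
    [/\ a = lambda2 wl, b = lambda2 wr & a < b] &
    [/\ {within `[a, b], continuous U}, {within `[a, b], continuous P},
        (U a, P a) = wl & (U b, P b) = wr] &
    forall xi, a < xi < b ->
      [/\ lambda2 (U xi, P xi) = xi,
          is_derive xi 1 U 1 & is_derive xi 1 P (P xi / eps)]
| TwoShock (s : R) of
    a = s & b = s &
    s * (wr.1 - wl.1) = flux_u wr.1 - flux_u wl.1 &
    s * (wr.2 - wl.2) = wr.2 * wr.1 - wl.2 * wl.1 &
    lambda2 wr < s < lambda2 wl & lambda1 wl < s.

(* The values on the lines carrying a jump are left unspecified. *)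
Definition lax_fan wl wr (U P : R -> R) :=
  exists (wm : R * R) (s a b : R),
    [/\ one_wave wl wm s, two_wave wm wr U P a b & s <= a] /\
    [/\ forall xi, xi < s -> (U xi, P xi) = wl,
        forall xi, s < xi < a -> (U xi, P xi) = wm &
        forall xi, b < xi -> (U xi, P xi) = wr].

Definition lax_riemann_solution wl wr (u rho : R * R -> R) :=
  [/\ weak_solution u rho,
      initial_value u wl.1 wr.1, initial_value rho wl.2 wr.2 &
      exists U P : R -> R, lax_fan wl wr U P /\
        forall p, half_plane p ->
          u p = U (p.1 / p.2) /\ rho p = P (p.1 / p.2)].

(* At t = 0 the derivative is the one-sided one, m' 0. *)
Definition C1_halfline (m : R -> R) :=
  {within `[0, +oo[, continuous m} /\
  exists m' : R -> R, {within `[0, +oo[, continuous m'} /\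
    forall t : R, 0 < t -> is_derive t 1 m (m' t).

Definition delta_wave_solution wl wr (u : R * R -> R) (rho : distr) :=
  exists (s udelta : R) (m : R -> R),
    [/\ C1_halfline m, m 0 = 0,
        forall p, half_plane p -> u p = step s wl.1 udelta wr.1 p &
        distr_eq rho (regular_distr (step s wl.2 0 wr.2)
                      \+ weighted_delta m (fun t => s * t))] /\
    conservation_law (regular_distr u) (regular_distr (fun p => flux_u (u p))) /\
    conservation_law rho
      (regular_distr (step s (wl.2 * wl.1) 0 (wr.2 * wr.1))
       \+ weighted_delta (fun t => m t * udelta) (fun t => s * t)).

End System.

Section Limits.
Context {R : realType}.
Implicit Types (p : R * R) (ul ur rhol rhor : R).

Definition fan_u ul ur : R * R -> R :=
  fun p => if p.1 < ul * p.2 then ul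
           else if p.1 < ur * p.2 then p.1 / p.2 else ur.

Definition fan_rho ul ur rhol rhor : R * R -> R :=
  fun p => if p.1 < ul * p.2 then rhol
           else if p.1 < ur * p.2 then 0 else rhor.

Definition delta_limit_u ul ur : R * R -> R :=
  step ((ul + ur) / 2) ul ((ul + ur) / 2) ur.

Definition delta_limit_rho ul ur rhol rhor : distr :=
  regular_distr (step ((ul + ur) / 2) rhol 0 rhor)
  \+ weighted_delta (fun t => (ul - ur) * (rhol + rhor) / 2 * t)
                    (fun t => (ul + ur) / 2 * t).

End Limits.

(* Main.v *)
Require Import Defs.
From HB Require Import structures.
From mathcomp Require Import all_boot all_order all_algebra.
From mathcomp Require Import all_classical all_reals all_analysis measurable_realfun.
From mathcomp Require Import ring lra.
Set Implicit Arguments.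
Unset Strict Implicit.
Unset Printing Implicit Defensive.
Import Order.TTheory GRing.Theory Num.Theory.
Import numFieldNormedType.Exports.
Local Open Scope classical_set_scope.
Local Open Scope ring_scope.

(** All the functions involved are self-similar, that is, functions W of
    xi = x / t, and everything is reduced to integrals over the xi-line.  For a
    test function phi, let ray w phi xi be the integral over t > 0 of
    w(t) phi(xi t, t), and write eta = ray 1 phi.  Passing to the coordinates
    (xi, t), whose Jacobian is t, turns the distribution W(x / t) into
    phi |-> int W(xi) (ray id phi xi) dxi ([regular_distr_polar]).  Moreover
    ray id phi_x = eta', and, integrating d/dt (t phi(xi t, t)) over t,
    ray id phi_t = - eta - xi eta' ([is_derive_eta], [ray_Dt]).  Hence the
    equation W_t + G_x = 0 tested against phi reads
      int ((G - xi W) eta' - W eta) dxi = 0      ([conservation_ray]).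
    With K = G - xi W, the integrand is (K eta)' wherever K' = - W, so that the
    equation holds as soon as K is continuous and piecewise a primitive of - W;
    continuity of K across a jump is the Rankine-Hugoniot condition.

    If u_l <= u_r, the algebra of Lax waves leaves only one candidate: u is
    xi - eps truncated to [u_l, u_r], and rho is rho_l for xi < u_l and
    rho_r exp((u - u_r) / eps) for xi > u_l; shocks are excluded because they
    would need u_r < u_l ([lax_fan_unique]).  On each piece K has the derivative
    required above, so this candidate is a solution
    ([lax_riemann_solution_exists]).  As eps tends to 0 its profiles are bounded
    and converge almost everywhere, rho to 0 on (u_l, u_r), and dominated
    convergence on the xi-line concludes ([lax_solutions_cvg]).

    If u_l > u_r, the two equations for a step of speed s with a delta of mass
    m(t) on x = s t become
      ((f(u_l) - f(u_r)) - s (u_l - u_r)) eta(s) = 0,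
      C eta(s) + ray m phi_t s + u_delta (ray m phi_x s) = 0,
    where C = rho_l u_l - rho_r u_r - s (rho_l - rho_r).  The first one gives
    s = (u_l + u_r) / 2 + eps.  In the second one, a test function for which
    phi_x vanishes on x = s t, so that phi_t is there the derivative of the
    trace of phi, eliminates u_delta and shows that m' = C; hence
    m(t) = C t, and conversely this mass with u_delta = s is a solution
    ([delta_wave_canonical], [delta_wave_exists]).  Therefore the delta part of
    rho is phi |-> C (ray id phi s), which depends continuously on s, and C
    tends to (u_l - u_r) (rho_l + rho_r) / 2 ([delta_waves_cvg]). *)

(** * Measurability in the plane *)

Section PlaneMeasurability.
Context {R : realType}.

(** The sigma-algebra of the plane is the product one, so Borel sets have to be
    built from boxes: an open set is the union of the countably many boxes with
    rational corners that it contains. *)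
Lemma open_measurable_plane (A : set (R * R)) : open A ->
  measurable (A : set (measurableTypeR R * measurableTypeR R)).
Proof.
move=> oA.
pose box (q : (rat * rat) * (rat * rat)) : set (R * R) :=
  [set` `]ratr q.1.1, ratr q.1.2[] `*` [set` `]ratr q.2.1, ratr q.2.2[].
have -> : A = \bigcup_(q in [set q | box q `<=` A]) box q.
  apply/seteqP; split=> [[x y] Axy|p [q /= + qp]]; last exact.
  have /nbhs_ballP[e /= e0 eA] : nbhs (x, y) A by exact: open_nbhs_nbhs.
  have /rat_in_itvoo[q1] : x - e < x by lra.
  have /rat_in_itvoo[q2] : x < x + e by lra.
  have /rat_in_itvoo[q3] : y - e < y by lra.
  have /rat_in_itvoo[q4] : y < y + e by lra.
  rewrite !in_itv/= => /andP[h7 h8] /andP[h5 h6] /andP[h3 h4] /andP[h1 h2].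
  exists ((q1, q2), (q3, q4)).
    move=> [u v] []/=; rewrite !in_itv/= => /andP[u1 u2] /andP[v1 v2].
    apply: eA; split; rewrite /ball/= ltr_norml; lra.
  by split; rewrite /= in_itv/=; apply/andP.
rewrite bigcup_mkcond.
apply: countable_bigcupT_measurable => // q; case: ifPn => // _.
exact: measurableX.
Qed.

Lemma continuous_measurable_plane (f : R * R -> R) : continuous f ->
  measurable_fun setT
    (f : measurableTypeR R * measurableTypeR R -> measurableTypeR R).
Proof.
move=> cf; apply: (measurability _ (RGenOpens.measurableE R)) => _ [_ [a [b ->] <-]].
rewrite setTI; apply: open_measurable_plane.
by apply: open_comp => // p _; exact: cf.
Qed.

Lemma compact_measurable_plane (K : set (R * R)) : compact K ->
  measurable (K : set (measurableTypeR R * measurableTypeR R)).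
Proof.
move=> cK; rewrite -(setCK K); apply: measurableC.
apply: open_measurable_plane; rewrite openC.
by apply: compact_closed => //; exact: norm_hausdorff.
Qed.

End PlaneMeasurability.

(** * Integration of compactly supported functions; dilations of the line *)

Section IntegralTools.
Context {R : realType}.
Notation leb := (@lebesgue_measure R).

Lemma inv_measurable :
  measurable_fun setT (GRing.inv : measurableTypeR R -> measurableTypeR R).
Proof.
rewrite -(setUv [set (0 : R)]); apply/measurable_funU => //.
  exact: measurableC.
split; first exact: measurable_fun_set1.
apply: open_continuous_measurable_fun.
  by rewrite openC; exact: closed_eq.
by move=> x /set_mem/eqP x0; exact: inv_continuous.
Qed.

Lemma measurable_fun_ratio :
  measurable_fun setT
   (fun p : measurableTypeR R * measurableTypeR R => p.1 / p.2 : measurableTypeR R).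
Proof.
apply: measurable_funM; first exact: measurable_fst.
exact: (measurableT_comp inv_measurable measurable_snd).
Qed.

Lemma patch_support T (D : set T) (f : T -> R) :
  (forall x, f x != 0 -> D x) -> f \_ D = f.
Proof.
move=> fD; apply/funext => x; rewrite patchE; case: ifPn => // xD.
by have [->//|/fD/mem_set] := eqVneq (f x) 0; rewrite (negbTE xD).
Qed.

Lemma integrable_bounded_support d (T : measurableType d)
    (mu : {measure set T -> \bar R}) (D : set T) (f : T -> R) (B : R) :
  measurable D -> (mu D < +oo)%E -> measurable_fun setT f ->
  (forall x, `|f x| <= B) -> (forall x, f x != 0 -> D x) ->
  mu.-integrable setT (EFin \o f).
Proof.
move=> mD muD mf fB fD.
rewrite -(patch_support fD) -restrict_EFin.
apply/(integrable_mkcond _ mD); apply: measurable_bounded_integrable => //.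
  exact: measurable_funTS.
exists B; split; first exact: num_real.
by move=> M BM x _ /=; rewrite (le_trans (fB x))// ltW.
Qed.

Lemma Rintegral_support d (T : measurableType d)
    (mu : {measure set T -> \bar R}) (D : set T) (f : T -> R) :
  (forall x, f x != 0 -> D x) ->
  \int[mu]_(x in D) f x = \int[mu]_x f x.
Proof. by move=> fD; rewrite Rintegral_mkcond patch_support. Qed.

Lemma integral_mscale d (T : measurableType d) (mu : {measure set T -> \bar R})
    (k : {nonneg R}) (f : T -> \bar R) :
  mu.-integrable setT f ->
  (\int[mscale k mu]_x f x = k%:num%:E * \int[mu]_x f x)%E.
Proof.
move=> intf; have mf := measurable_int _ intf.
rewrite (integralE mu) (integralE (mscale k mu)) !ge0_integral_mscale//;
  [|exact: measurable_funeneg|exact: measurable_funepos].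
by rewrite [RHS]muleBr//; exact: integrable_add_def.
Qed.

Section Dilation.
Variables (t : R) (t0 : 0 < t).

Let dil (x : measurableTypeR R) : measurableTypeR R := x * t.

Let measurable_dil : measurable_fun setT dil.
Proof. exact: mulrr_measurable. Qed.

Let image : {measure set (measurableTypeR R) -> \bar R}.
Proof.
by refine (pushforward leb dil : {measure set _ -> \bar R}); exact: measurable_dil.
Defined.

Let dilated : {measure set (measurableTypeR R) -> \bar R} :=
  mscale (NngNum (ltW t0)) image.

Let lebesgue_dilate (A : set (measurableTypeR R)) : measurable A ->
  leb A = dilated A.
Proof.
apply: lebesgue_measure_unique => _ [[a b] _ <-].
have -> : dilated [set` `]a, b]] = (t%:E * leb (dil @^-1` [set` `]a, b]]))%E by [].
have -> : dil @^-1` [set` `]a, b]] = [set` `](a / t), (b / t)]].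
  apply/seteqP; split => x; rewrite /= /dil !in_itv/=.
    by rewrite ltr_pdivrMr// ler_pdivlMr.
  by rewrite ltr_pdivrMr// ler_pdivlMr.
rewrite !lebesgue_measure_itv/= !lte_fin ltr_pM2r ?invr_gt0//.
case: ifPn => _; last by rewrite mule0.
by rewrite -!EFinB -EFinM; congr EFin; field; exact: lt0r_neq0.
Qed.

(** The image of Lebesgue measure under x |-> x t, multiplied by t, gives
    the interval ]a, b] its length, hence is Lebesgue measure. *)
Lemma integral_dilate (f : R -> R) :
  measurable_fun setT (f : measurableTypeR R -> measurableTypeR R) ->
  leb.-integrable setT (fun x => (f (x * t))%:E) ->
  (\int[leb]_x (f x)%:E = \int[leb]_x (t * f (x * t))%:E)%E.
Proof.
move=> mf intf.
have mfE : measurable_fun setT (EFin \o f : measurableTypeR R -> \bar R).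
  exact/measurable_EFinP.
rewrite [LHS](eq_measure_integral dilated); last first.
  by move=> A mA _; exact: lebesgue_dilate.
under [RHS]eq_integral do rewrite EFinM.
rewrite integralZl//.
have -> : (\int[leb]_x (f (x * t))%:E =
    \int[image]_x (f x)%:E)%E.
  by rewrite /image integral_pushforward.
have intimage : image.-integrable setT (EFin \o f).
  exact: integrable_pushforward.
exact: integral_mscale.
Qed.

End Dilation.

End IntegralTools.

(** * Self-similar functions as distributions *)

Section Polar.
Context {R : realType}.
Notation leb := (@lebesgue_measure R).
Implicit Types (W : R -> R) (f : R * R -> R).

Lemma continuous_fst_plane : continuous (fst : R * R -> R).
Proof. by move=> p; exact: cvg_fst. Qed.

Lemma continuous_snd_plane : continuous (snd : R * R -> R).
Proof. by move=> p; exact: cvg_snd. Qed.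

Lemma continuous_plane_comp (T : topologicalType) (u v : T -> R) f :
  continuous u -> continuous v -> continuous f ->
  continuous (fun x => f (u x, v x)).
Proof.
move=> cu cv cf x.
apply: (@continuous_comp _ _ _ (fun x => (u x, v x)) f); last exact: cf.
exact: (cvg_pair (cu x) (cv x)).
Qed.

Definition bounded_measurable W :=
  measurable_fun setT (W : measurableTypeR R -> measurableTypeR R) /\
  exists B, forall x, `|W x| <= B.

(** The box stays away from t = 0 as soon as 0 < c.  This keeps xi = x / t
    bounded on the support, and makes t-integrals integrals over [c, d]. *)
Definition boxed (A c d : R) f :=
  continuous f /\ forall p, f p != 0 -> `|p.1| < A /\ c < p.2 < d.

(** With w = 1 this is the integral of f along the line x = xi t, parametrized by
    time; with w = id the weight is the Jacobian of (xi, t) |-> (xi t, t), and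
    the function of xi so obtained is the density of f in the variable x / t. *)
Definition ray (w : R -> R) f (xi : R) : R :=
  weighted_delta w (fun t => xi * t) f.

Lemma boxed_bounded A c d f : boxed A c d f ->
  exists2 B, 0 <= B & forall p, `|f p| <= B.
Proof.
move=> [cf fs].
pose K : set (R * R) := [set` `[- A, A]] `*` [set` `[c, d]].
have cK : compact K by apply: compact_setX; exact: segment_compact.
have : bounded_set (f @` K).
  apply: compact_bounded; apply: continuous_compact => //.
  exact: continuous_subspaceT.
move=> [M [_ MP]]; exists (`|M| + 1) => [|p]; first by rewrite addr_ge0.
have [->|/fs[h1 /andP[h2 h3]]] := eqVneq (f p) 0.
  by rewrite normr0 addr_ge0.
apply: (MP (`|M| + 1)); first by rewrite (le_lt_trans (ler_norm _))// ltrDl.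
exists p => //; split; rewrite /= in_itv/=; first by rewrite -ler_norml ltW.
by rewrite !ltW.
Qed.

Lemma integrable_box (f : measurableTypeR R * measurableTypeR R -> measurableTypeR R)
    (A c d B : R) :
  measurable_fun setT f -> (forall p, `|f p| <= B) ->
  (forall p, f p != 0 -> `|p.1| < A /\ c < p.2 < d) ->
  lebesgue2.-integrable setT (EFin \o f).
Proof.
move=> mf fB fs.
apply: (@integrable_bounded_support R _ _ lebesgue2
  ([set` `[- A, A]] `*` [set` `[c, d]]) f B) => //.
- exact: measurableX.
- have -> : lebesgue2 ([set` `[- A, A]] `*` [set` `[c, d]]) =
      (leb [set` `[(- A)%R, A]] * leb [set` `[c, d]])%E.
    exact: product_measure1E.
  by rewrite !lebesgue_measure_itv/=; do 2!case: ifP => _;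
    rewrite ?mul0e ?mule0// -?EFinB -?EFinM ?ltry.
- move=> p /fs[h1 /andP[h2 h3]]; split; rewrite /= in_itv/= ?(ltW h2) ?(ltW h3)//.
  by rewrite -ler_norml ltW.
Qed.

Lemma integrable_segment (f : R -> R) (a b B : R) :
  measurable_fun setT (f : measurableTypeR R -> measurableTypeR R) ->
  (forall x, `|f x| <= B) -> (forall x, f x != 0 -> a <= x <= b) ->
  leb.-integrable setT (EFin \o f).
Proof.
move=> mf fB fs.
apply: (@integrable_bounded_support R _ _ leb [set` `[a, b]] f B) => //.
by rewrite [X in (X < _)%E](lebesgue_measure_itv `[a, b])/=;
  case: ifP => _; rewrite -?EFinB ltry.
Qed.

(** The change of variables (x, t) = (xi t, t).  It is made slice by slice,
    dilating the x-line by t for each fixed t, between two uses of Fubini. *)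
Lemma regular_distr_polar F W A c d f :
  0 < c -> bounded_measurable W -> boxed A c d f ->
  (forall p, half_plane p -> F p = W (p.1 / p.2)) ->
  regular_distr F f = \int[leb]_xi (W xi * ray id f xi).
Proof.
move=> c0 [mW [BW WB]] bf FW; have [B B0 fB] := boxed_bounded bf.
have [cf fs] := bf.
have BW0 : 0 <= BW by exact: le_trans (WB 0).
have tpos p : f p != 0 -> 0 < p.2 by move=> /fs[_ /andP[? _]]; lra.
pose g (p : measurableTypeR R * measurableTypeR R) : measurableTypeR R :=
  W (p.1 / p.2) * f p.
pose h (p : R * R) : R := p.2 * f (p.1 * p.2, p.2).
pose k (p : measurableTypeR R * measurableTypeR R) : measurableTypeR R :=
  W p.1 * h p.
have mg : measurable_fun setT g.
  apply: measurable_funM; last exact: continuous_measurable_plane.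
  exact: (measurableT_comp mW measurable_fun_ratio).
have ch : continuous h.
  move=> p; apply: continuousM; first exact: continuous_snd_plane.
  apply: continuous_plane_comp => // {}p; last exact: continuous_snd_plane.
  by apply: continuousM; [exact: continuous_fst_plane|exact: continuous_snd_plane].
have mk : measurable_fun setT k.
  apply: measurable_funM; first exact: (measurableT_comp mW measurable_fst).
  exact: continuous_measurable_plane.
have ig : lebesgue2.-integrable setT (EFin \o g).
  apply: (@integrable_box _ A c d (BW * B)) => // p.
    by rewrite normrM ler_pM.
  by rewrite /g mulf_eq0 negb_or => /andP[_ /fs].
have hs p : h p != 0 -> `|p.1| < A / c /\ c < p.2 < d.
  rewrite mulf_eq0 negb_or => /andP[_ /fs/=[h1 /andP[h2 h3]]].
  have t0 : 0 < p.2 by exact: lt_trans h2.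
  split; last by rewrite h2.
  rewrite ltr_pdivlMr//; apply: le_lt_trans h1; rewrite normrM.
  by rewrite ler_wpM2l// gtr0_norm// ltW.
have hB p : `|h p| <= `|d| * B.
  have [->|/hs[_ /andP[h2 h3]]] := eqVneq (h p) 0.
    by rewrite normr0 mulr_ge0.
  rewrite /h normrM ler_pM// gtr0_norm; last exact: lt_trans h2.
  by rewrite (le_trans (ltW h3))// ler_norm.
have ik : lebesgue2.-integrable setT (EFin \o k).
  apply: (@integrable_box _ (A / c) c d (BW * (`|d| * B))) => // p.
    by rewrite normrM ler_pM.
  by rewrite /k mulf_eq0 negb_or => /andP[_ /hs].
(* For y <= 0 both integrands vanish, since f does. *)
have slice y : (\int[leb]_x (g (x, y))%:E = \int[leb]_x (k (x, y))%:E)%E.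
  have [y0|y0] := leP y 0.
    apply: eq_integral => x _; congr EFin; rewrite /g /k /h/=.
    have f0 z : f (z, y) = 0.
      by apply/eqP; apply: contraT => /tpos/=; rewrite ltNge y0.
    by rewrite !f0 !mulr0.
  rewrite (integral_dilate y0).
  - apply: eq_integral => x _; congr EFin; rewrite /g /k /h/= mulfK ?lt0r_neq0//.
    by rewrite mulrCA.
  - exact: measurableT_comp mg (pair2_measurable y).
  - apply: (@integrable_segment (fun x => g (x * y, y)) (- (A / y)) (A / y)
        (BW * B)) => [|x|x].
    + have mxy : measurable_fun setT
          ((fun x => x * y) : measurableTypeR R -> measurableTypeR R).
        exact: mulrr_measurable.
      exact: measurableT_comp (measurableT_comp mg (pair2_measurable y)) mxy.
    + by rewrite normrM ler_pM.
    + rewrite mulf_eq0 negb_or => /andP[_ /fs/=[+ _]].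
      rewrite normrM (gtr0_norm y0) -ltr_pdivlMr// => /ltW.
      by rewrite ler_norml.
have inner x : (\int[leb]_y (k (x, y))%:E = (W x * ray id f x)%:E)%E.
  have ih : leb.-integrable setT (EFin \o (fun y => h (x, y))).
    apply: (@integrable_segment _ c d (`|d| * B)) => [|y|y /hs[_ /=/andP[h2 h3]]].
    - apply: continuous_measurable_fun => y.
      apply: (@continuous_comp _ _ _ (pair x) h); last exact: ch.
      by exact: (cvg_pair (cvg_cst x) cvg_id).
    - exact: hB.
    - by rewrite !ltW.
  have -> : (\int[leb]_y (k (x, y))%:E =
      \int[leb]_y ((W x)%:E * (h (x, y))%:E))%E by [].
  rewrite integralZl// EFinM; congr (_ * _)%E.
  rewrite /ray /weighted_delta (@Rintegral_support _ _ _ leb) => [|y].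
    by rewrite /Rintegral fineK//; exact: integrable_fin_num.
  by move=> /(hs (x, y))[_ /andP[h2 _]]; rewrite /= in_itv/= andbT; exact: lt_trans h2.
rewrite /regular_distr.
transitivity (\int[lebesgue2]_p g p).
  transitivity (\int[lebesgue2]_(p in half_plane) g p).
    by apply: eq_Rintegral => p /set_mem hp; rewrite FW.
  apply: Rintegral_support => p.
  by rewrite /g mulf_eq0 negb_or => /andP[_ /tpos].
rewrite /Rintegral; congr fine.
rewrite -(integral21_prod_meas1 ig) /fubini_G.
transitivity (\int[leb]_y \int[leb]_x (k (x, y))%:E)%E.
  by apply: eq_integral => y _; exact: slice.
transitivity (\int[lebesgue2]_p (EFin \o k) p)%E.
  exact: integral21_prod_meas1.
rewrite -(integral12_prod_meas1 ik).
by apply: eq_integral => x _; exact: inner.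
Qed.

End Polar.

(** * Test functions and their partial derivatives *)

Section TestFunctions.
Context {R : realType}.
Notation leb := (@lebesgue_measure R).
Implicit Types (f phi : R * R -> R) (p : R * R).

Definition test_box phi A c d :=
  [/\ 0 < c, c < d, boxed A c d phi, boxed A c d (Dx phi) & boxed A c d (Dt phi)].

Lemma supp_derive phi v p : 'D_v phi p != 0 -> supp phi p.
Proof.
move=> Dp; apply: contrapT => nsp.
suff near0 : \forall q \near p, phi q = cst 0 q.
  by move: Dp; rewrite (near_eq_derive _ near0) derive_cst eqxx.
have : nbhs p (~` supp phi).
  apply: open_nbhs_nbhs; split => //; rewrite openC; exact: closed_closure.
apply: filterS => q nq; apply/eqP; apply: contra_notT nq => phiq.
exact: subset_closure.
Qed.

(** A compact set contained in t > 0 lies in t > c for some c > 0, since the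
    set of its times is closed and misses 0. *)
Lemma test_function_box phi : test_function phi ->
  exists A c d, test_box phi A c d.
Proof.
move=> [sphi csupp sub].
have [M [_ MP]] := compact_bounded csupp.
pose A := `|M| + 2.
have bnd p : supp phi p -> `|p.1| < A /\ p.2 < A.
  move=> sp; have MA : M < `|M| + 1 by rewrite (le_lt_trans (ler_norm M))// ltrDl.
  have := MP _ MA p sp.
  rewrite /= prod_normE ge_max => /andP[h1 h2].
  have := ler_norm p.2; rewrite /A; split; lra.
have [c [c0 c1 cP]] : exists c, [/\ 0 < c, c < 1 & forall p, supp phi p -> c < p.2].
  have csnd : closed (snd @` supp phi).
    apply: compact_closed; first exact: Rhausdorff.
    apply: continuous_compact => //.
    exact/continuous_subspaceT/continuous_snd_plane.
  have : nbhs (0 : R) (~` (snd @` supp phi)).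
    apply: open_nbhs_nbhs; split; first by rewrite openC.
    by move=> [p /sub]; rewrite /half_plane/= => /[swap] ->; rewrite ltxx.
  move=> /nbhs_ballP[e /= e0 eP]; exists (Num.min (e / 2) 2^-1); split.
  - by rewrite lt_min invr_gt0 ltr0n divr_gt0.
  - by rewrite gt_min; apply/orP; right; lra.
  - move=> p sp; rewrite gt_min; apply/orP; left.
    have p0 := sub _ sp; rewrite /half_plane/= in p0.
    rewrite ltNge; apply/negP => pe; apply: (eP p.2); last by exists p.
    by rewrite /ball/= sub0r normrN gtr0_norm//; lra.
have box f : continuous f -> (forall p, f p != 0 -> supp phi p) -> boxed A c A f.
  move=> cf fs; split => // p /fs sp; have [h1 h2] := bnd _ sp.
  by split=> //; rewrite cP.
exists A, c, A; split => //.
- by rewrite (lt_trans c1)// /A; have := normr_ge0 M; lra.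
- apply: box; first by have [] := sphi 0%N.
  by move=> p phip; exact: subset_closure.
- apply: box; last by move=> p; exact: supp_derive.
  by have [_ [_ _ []]] := sphi 1%N.
- apply: box; last by move=> p; exact: supp_derive.
  by have [_ [_ _ _ []]] := sphi 1%N.
Qed.

Lemma smooth_derivable phi : smooth phi ->
  (forall p, derivable phi p (1, 0)) /\ (forall p, derivable phi p (0, 1)).
Proof. by move=> /(_ 1%N)[_ []]. Qed.

Lemma is_derive_Dx f x t : derivable f (x, t) (1, 0) ->
  is_derive x 1 (fun x => f (x, t)) (Dx f (x, t)).
Proof.
move=> df.
have E : (fun h : R => h^-1 *: (f (h *: ((1, 0) : R * R) + (x, t)) - f (x, t))) =
         (fun h : R => h^-1 *: (f (h *: 1 + x, t) - f (x, t))).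
  apply/funext => h; congr (_ *: (f _ - _)).
  by apply: injective_projections => //=; rewrite scaler0 add0r.
split; first by move: df; rewrite /derivable E.
by rewrite /Dx /derive E.
Qed.

Lemma is_derive_Dt f x t : derivable f (x, t) (0, 1) ->
  is_derive t 1 (fun t => f (x, t)) (Dt f (x, t)).
Proof.
move=> df.
have E : (fun h : R => h^-1 *: (f (h *: ((0, 1) : R * R) + (x, t)) - f (x, t))) =
         (fun h : R => h^-1 *: (f (x, h *: 1 + t) - f (x, t))).
  apply/funext => h; congr (_ *: (f _ - _)).
  by apply: injective_projections => //=; rewrite scaler0 add0r.
split; first by move: df; rewrite /derivable E.
by rewrite /Dt /derive E.
Qed.

End TestFunctions.

(** * Integrals of test functions along rays *)

Section Rays.
Context {R : realType}.
Notation leb := (@lebesgue_measure R).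
Implicit Types (f phi : R * R -> R) (p : R * R).

(** A quantitative mean value theorem that allows for both orders of the points
    a and b; it replaces total differentiability in the chain rule below. *)
Lemma mean_value_bound (f df : R -> R) (L e a b : R) :
  (forall x : R, is_derive x 1 f (df x)) ->
  (forall x, `|x - a| <= `|b - a| -> `|df x - L| <= e) ->
  `|f b - f a - L * (b - a)| <= e * `|b - a|.
Proof.
move=> fdf dfL.
have cf : continuous f.
  move=> x; apply/differentiable_continuous/derivable1_diffP.
  by have [] := fdf x.
have [ab|ba|->] := ltgtP a b; last by rewrite !subrr mulr0 subr0 normr0 mulr0.
  have [c /[!in_itv]/= /andP[ac cb] ->] := @MVT _ f df a b ab (fun x _ => fdf x)
    (continuous_subspaceT cf).
  rewrite -mulrBl normrM ler_wpM2r// dfL// !gtr0_norm ?subr_gt0//.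
  by rewrite lerD2r ltW.
have [c /[!in_itv]/= /andP[ac cb] E] := @MVT _ f df b a ba (fun x _ => fdf x)
    (continuous_subspaceT cf).
rewrite -[f b - f a]opprB E -mulrN opprB -mulrBl normrM ler_wpM2r// dfL//.
by rewrite !ltr0_norm ?subr_lt0// lerN2 lerD2r ltW.
Qed.

(** Partial derivatives do not suffice for the chain rule along a line; here one
    of them is continuous.  The increment is split into a vertical one, given by
    the derivative at the point, and a horizontal one at the later time, which
    the mean value theorem controls by the continuity of Dx phi. *)
Lemma is_derive_ray phi (xi t : R) :
  (forall p, derivable phi p (1, 0)) -> (forall p, derivable phi p (0, 1)) ->
  continuous (Dx phi) ->
  is_derive t 1 (fun s => phi (xi * s, s))
    (xi * Dx phi (xi * t, t) + Dt phi (xi * t, t)).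
Proof.
move=> dx dt cDx; set L := Dx phi _; set L' := Dt phi _.
have dt' := is_derive_Dt (dt (xi * t, t)).
have vert : h^-1 *: (phi (xi * t, h *: 1 + t) - phi (xi * t, t)) @[h --> 0^'] --> L'.
  rewrite /L' -(@derive_val _ _ _ _ _ _ _ dt').
  exact: (@ex_derive _ _ _ _ _ _ _ dt').
have horiz : h^-1 *: (phi (xi * (h *: 1 + t), h *: 1 + t) - phi (xi * t, h *: 1 + t))
    @[h --> 0^'] --> xi * L.
  apply/cvgrPdist_le => e e0.
  have e'0 : 0 < e / (1 + `|xi|) by rewrite divr_gt0// ltr_pwDl.
  have := cDx (xi * t, t) => /cvgrPdist_le /(_ _ e'0) /nbhs_ballP[r /= r0 rP].
  have r'0 : 0 < r / (1 + `|xi|) by rewrite divr_gt0// ltr_pwDl.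
  near=> h.
  have h0 : h != 0 by near: h; exact: nbhs_dnbhs_neq.
  have hr : `|h| < r / (1 + `|xi|).
    near: h; apply: dnbhs0_lt; exact: r'0.
  have hr1 : `|h| < r /\ `|xi| * `|h| < r.
    move: hr; rewrite ltr_pdivlMr ?ltr_pwDl// => hr.
    have := normr_ge0 xi; have := normr_ge0 h; nra.
  have := @mean_value_bound (fun x => phi (x, h *: 1 + t))
    (fun x => Dx phi (x, h *: 1 + t)) L (e / (1 + `|xi|)) (xi * t) (xi * (h *: 1 + t))
    (fun x => is_derive_Dx (dx _)).
  have -> : xi * (h *: 1 + t) - xi * t = xi * h.
    by rewrite /GRing.scale/=; ring.
  move=> /(_ _)-H.
  have {}H : `|phi (xi * (h *: 1 + t), h *: 1 + t) - phi (xi * t, h *: 1 + t) -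
      L * (xi * h)| <= e / (1 + `|xi|) * `|xi * h|.
    apply: H => x xr; rewrite distrC; apply: rP; split; rewrite /ball/=.
      by rewrite distrC (le_lt_trans xr)// normrM; case: hr1.
    by rewrite /GRing.scale/= mulr1 opprD addrCA subrr addr0 normrN; case: hr1.
  rewrite distrC.
  set D := _ - phi (xi * t, _) in H *.
  have -> : h^-1 *: D - xi * L = h^-1 * (D - L * (xi * h)).
    by rewrite /GRing.scale/=; field.
  rewrite normrM normfV ler_pdivrMl ?normr_gt0//.
  apply: (le_trans H); rewrite normrM.
  set q := e / (1 + `|xi|) in e'0 *.
  have -> : e = q * (1 + `|xi|) by rewrite /q divfK// gt_eqF// ltr_pwDl.
  have := mulr_ge0 (ltW e'0) (normr_ge0 h); lra.
suff E : (fun h : R => h^-1 *: (phi (xi * (h *: 1 + t), h *: 1 + t) - phi (xi * t, t))) =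
  (fun h : R => h^-1 *: (phi (xi * (h *: 1 + t), h *: 1 + t) - phi (xi * t, h *: 1 + t)))
  \+ (fun h : R => h^-1 *: (phi (xi * t, h *: 1 + t) - phi (xi * t, t))).
  have lim : h^-1 *: (phi (xi * (h *: 1 + t), h *: 1 + t) - phi (xi * t, t))
      @[h --> 0^'] --> xi * L + L'.
    by rewrite E; exact: cvgD.
  split; first by apply/cvg_ex; exists (xi * L + L').
  exact: cvg_lim.
apply/funext => h /=; rewrite -scalerDr; congr (_ *: _).
by rewrite addrA subrK.
Unshelve. all: by end_near. Qed.

Lemma boxed_segment A c d f (w : R -> R) xi : 0 < c -> boxed A c d f ->
  ray w f xi = \int[leb]_(t in `[c, d]) (w t * f (xi * t, t)).
Proof.
move=> c0 [_ fs]; rewrite /ray /weighted_delta.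
rewrite (@Rintegral_support _ _ _ leb [set` `]0, +oo[]%R); last first.
  move=> t; rewrite mulf_eq0 negb_or => /andP[_ /fs/=[_ /andP[ct _]]].
  by rewrite in_itv/= andbT; exact: lt_trans ct.
rewrite (@Rintegral_support _ _ _ leb [set` `[c, d]])// => t.
rewrite mulf_eq0 negb_or => /andP[_ /fs/=[_ /andP[ct td]]].
by rewrite in_itv/= !ltW.
Qed.

Lemma ray_support A c d f w xi : 0 < c -> boxed A c d f ->
  A / c <= `|xi| -> ray w f xi = 0.
Proof.
move=> c0 bf Axi; rewrite (boxed_segment _ _ c0 bf).
have [_ fs] := bf.
rewrite (eq_Rintegral _ (g := cst 0)) ?Rintegral_cst ?mul0r// => t /set_mem.
rewrite /= in_itv/= => /andP[ct td].
apply/eqP; rewrite mulf_eq0; apply/orP; right; apply/negP => /negP /fs/=[h _].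
have t0 : 0 < t by exact: lt_le_trans ct.
move: h; rewrite ltNge normrM => /negP; apply.
move: Axi; rewrite ler_pdivrMr// => /le_trans; apply.
by rewrite ler_wpM2l// gtr0_norm.
Qed.

Lemma continuous_along_ray f (w : R -> R) xi : continuous f -> continuous w ->
  continuous (fun t => w t * f (xi * t, t)).
Proof.
move=> cf cw t; apply: continuousM; first exact: cw.
apply: continuous_plane_comp => // s; last exact: cvg_id.
exact: mulrl_continuous.
Qed.

Lemma continuous_integrable_segment (f : R -> R) a b : continuous f ->
  leb.-integrable `[a, b] (EFin \o f).
Proof.
move=> cf; apply: continuous_compact_integrable; first exact: segment_compact.
exact: continuous_subspaceT.
Qed.

Lemma integrable_along_ray f (w : R -> R) c d xi : continuous f -> continuous w ->
  leb.-integrable `[c, d] (EFin \o (fun t => w t * f (xi * t, t))).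
Proof.
by move=> cf cw; apply: continuous_integrable_segment; exact: continuous_along_ray.
Qed.

Lemma segment_bounded (w : R -> R) c d : continuous w ->
  exists M, forall t, c <= t <= d -> `|w t| <= M.
Proof.
move=> cw; have : bounded_set (w @` `[c, d]).
  apply: compact_bounded; apply: continuous_compact; last exact: segment_compact.
  exact: continuous_subspaceT.
move=> [M [_ MP]]; exists (`|M| + 1) => t tcd.
apply: (MP (`|M| + 1)); first by rewrite (le_lt_trans (ler_norm _))// ltrDl.
by exists t => //; rewrite /= in_itv.
Qed.

Lemma continuous_ray A c d f (w : R -> R) : 0 < c -> boxed A c d f -> continuous w ->
  continuous (ray w f).
Proof.
move=> c0 bf cw xi; have [cf _] := bf; have [B B0 fB] := boxed_bounded bf.
have [M wM] := segment_bounded c d cw.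
have -> : ray w f = fun xi => \int[leb]_(t in `[c, d]) (w t * f (xi * t, t)).
  by apply/funext => x; exact: boxed_segment c0 bf.
apply: (@continuity_under_integral R _ _ leb (fun xi t => w t * f (xi * t, t)) `[c, d]
  _ (xi - 1) (xi + 1) _ _ (cst (M * B))).
- by [].
- by move=> x _; exact: integrable_along_ray.
- apply: aeW => t _ x _; apply: continuousM; first exact: cst_continuous.
  apply: continuous_plane_comp => //; first by move=> s; exact: mulrr_continuous.
  by move=> s; exact: cst_continuous.
- by apply: continuous_integrable_segment => s; exact: cst_continuous.
- move=> x _; apply: aeW => t; rewrite /= in_itv/= => tcd.
  by rewrite normrM ler_pM// wM.
- by rewrite inE/= in_itv/=; lra.
Qed.

(** Differentiation under the integral sign: for fixed t, the derivative of
    phi(xi t, t) in xi is t (Dx phi)(xi t, t). *)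
Lemma is_derive_eta phi A c d (xi : R) :
  (forall p, derivable phi p (1, 0)) -> test_box phi A c d ->
  is_derive xi 1 (ray (cst 1) phi) (ray id (Dx phi) xi).
Proof.
move=> dx [c0 cd bp bx _]; have [cp _] := bp; have [cx _] := bx.
have [B B0 xB] := boxed_bounded bx.
pose g (x t : R) := cst 1 t * phi (x * t, t).
have c1 : continuous (cst 1 : R -> R) by move=> s; exact: cst_continuous.
have dg (x t : R) : is_derive x 1 (g ^~ t) (t * Dx phi (x * t, t)).
  have h1 : is_derive x 1 (fun x : R => x * t) t.
    have -> : (fun x : R => x * t) = t \*: id.
      by apply/funext => y; rewrite /= mulrC.
    by apply: is_derive_eq; exact: mulr1.
  have := @is_derive1_comp R (fun y => phi (y, t)) (fun y => y * t) x _ _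
    (is_derive_Dx (dx (x * t, t))) h1.
  by rewrite mulrC /comp /g; under [in X in _ -> X]eq_fun do rewrite mul1r.
have E : ray (cst 1) phi = fun xi => \int[leb]_(t in `[c, d]) g xi t.
  by apply/funext => x; exact: boxed_segment c0 bp.
have Ix : `]xi - 1, xi + 1[%classic xi by rewrite /= in_itv/=; lra.
have gP (x t : R) : partial1of2 g x t = t * Dx phi (x * t, t).
  by rewrite partial1of2E; exact: derive_val.
have intg x : `]xi - 1, xi + 1[%classic x -> leb.-integrable `[c, d] (EFin \o g x).
  by move=> _; exact: integrable_along_ray.
have dgx (x t : R) : `]xi - 1, xi + 1[%classic x -> `[c, d]%classic t ->
  derivable (g ^~ t) x 1 by move=> _ _; exact: ex_derive.
have Gub (x t : R) : `]xi - 1, xi + 1[%classic x -> `[c, d]%classic t ->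
    `|partial1of2 g x t| <= cst (d * B) t.
  move=> _; rewrite /= in_itv/= => /andP[ct td]; rewrite gP normrM ler_pM//.
  by rewrite ger0_norm// (le_trans (ltW c0)).
have intG : leb.-integrable `[c, d] (EFin \o cst (d * B)).
  by apply: continuous_integrable_segment => s; exact: cst_continuous.
have G0 (t : R) : 0 <= cst (d * B) t.
  by rewrite /= mulr_ge0// (le_trans _ (ltW cd))// ltW.
split.
  rewrite E; exact: (derivable_under_integral _ Ix intg dgx G0 intG Gub).
rewrite -derive1E E (differentiation_under_integral _ Ix intg dgx G0 intG Gub)//.
rewrite (boxed_segment _ _ c0 bx); apply: eq_Rintegral => t _.
exact: gP.
Qed.

Lemma is_derive_continuous (f df : R -> R) :
  (forall x : R, is_derive x 1 f (df x)) -> continuous f.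
Proof.
move=> fdf x; apply/differentiable_continuous/derivable1_diffP.
by have [] := fdf x.
Qed.

Lemma FTC_segment (f F : R -> R) a b : a <= b ->
  {within `[a, b], continuous f} -> {within `[a, b], continuous F} ->
  (forall x, a < x < b -> is_derive x 1 F (f x)) ->
  \int[leb]_(x in `[a, b]) f x = F b - F a.
Proof.
rewrite le_eqVlt => /predU1P[<- _ _ _|ab cf cF dF].
  by rewrite set_itv1 Rintegral_set1 subrr.
rewrite /Rintegral (@continuous_FTC2 _ f F)//.
- have /(continuous_within_itvP _ ab)[_ Fa Fb] := cF.
  split => // x; rewrite in_itv/= => xab.
  by have [] := dF _ xab.
- move=> x; rewrite in_itv/= => xab; rewrite derive1E.
  exact: (@derive_val _ _ _ _ _ _ _ (dF _ xab)).
Qed.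

(** The integral over t of d/dt (t phi(xi t, t)) vanishes, and by the chain rule
    this derivative is phi + t (xi Dx phi + Dt phi). *)
Lemma ray_Dt phi A c d (xi : R) :
  (forall p, derivable phi p (1, 0)) -> (forall p, derivable phi p (0, 1)) ->
  test_box phi A c d ->
  ray id (Dt phi) xi = - ray (cst 1) phi xi - xi * ray id (Dx phi) xi.
Proof.
move=> dx dt [c0 cd bp bx bt].
have [[cp sp] [cx _] [ct _]] := And3 bp bx bt.
have c1 : continuous (cst 1 : R -> R) by move=> s; exact: cst_continuous.
have cid : continuous (id : R -> R) by move=> s; exact: cvg_id.
pose F t : R := t * phi (xi * t, t).
pose f1 t : R := cst 1 t * phi (xi * t, t).
pose f2 t : R := id t * Dx phi (xi * t, t).
pose f3 t : R := id t * Dt phi (xi * t, t).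
have c1' : continuous f1 by exact: continuous_along_ray.
have c2' : continuous f2 by exact: continuous_along_ray.
have c3' : continuous f3 by exact: continuous_along_ray.
have i1 : leb.-integrable `[c, d] (EFin \o f1) by exact: integrable_along_ray.
have i2 : leb.-integrable `[c, d] (EFin \o f2) by exact: integrable_along_ray.
have i3 : leb.-integrable `[c, d] (EFin \o f3) by exact: integrable_along_ray.
have dF (t : R) : is_derive t 1 F (f1 t + xi * f2 t + f3 t).
  have h := is_derive_ray xi t dx dt cx : is_derive t 1 (fun s => phi (xi * s, s)) _.
  have -> : F = (id : R -> R) * (fun s => phi (xi * s, s)) by [].
  apply: is_derive_eq.
  by rewrite /f1 /f2 /f3 /GRing.scale/=; ring.
have cxi2 : continuous (fun t => xi * f2 t).
  by move=> t; apply: continuousM; [exact: cst_continuous|exact: c2'].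
have ixi2 : leb.-integrable `[c, d] (EFin \o (fun t => xi * f2 t)).
  exact: continuous_integrable_segment.
have cf : continuous (fun t => f1 t + xi * f2 t + f3 t).
  move=> t; apply: cvgD; last exact: c3'.
  by apply: cvgD; [exact: c1'|exact: cxi2].
have F0 t : t <= c \/ d <= t -> F t = 0.
  move=> tcd; apply/eqP; rewrite mulf_eq0; apply/orP; right.
  by apply/negP => /negP /sp /= [_]; lra.
have i12 : leb.-integrable `[c, d] (EFin \o (fun t => f1 t + xi * f2 t)).
  by apply: continuous_integrable_segment => t; apply: cvgD; [exact: c1'|exact: cxi2].
have := FTC_segment (ltW cd) (continuous_subspaceT cf)
  (continuous_subspaceT (is_derive_continuous dF)) (fun t _ => dF t).
rewrite (F0 c) ?(F0 d); [|by right|by left].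
rewrite (RintegralD _ i12 i3)// (RintegralD _ i1 ixi2)// (RintegralZl _ _ i2)//.
rewrite -(boxed_segment (cst 1) xi c0 bp).
rewrite -(boxed_segment id xi c0 bx) -(boxed_segment id xi c0 bt).
move: (ray _ phi xi) (ray _ (Dx _) xi) (ray _ (Dt _) xi) => x y z; clear; lra.
Qed.

End Rays.

(** * One-dimensional form of the conservation laws *)

Section Profiles.
Context {R : realType}.
Notation leb := (@lebesgue_measure R).
Implicit Types (W G : R -> R) (f phi : R * R -> R).

Lemma integrable_bounded_compact W g M : bounded_measurable W ->
  continuous g -> (forall x, M <= `|x| -> g x = 0) ->
  leb.-integrable setT (EFin \o (fun x => W x * g x)).
Proof.
move=> [mW [B WB]] cg gs.
have [C gC] := segment_bounded (- M) M cg.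
apply: (@integrable_segment _ _ (- M) M (B * `|C|)).
- by apply: measurable_funM => //; exact: continuous_measurable_fun.
- move=> x; rewrite normrM ler_pM//.
  have [xM|xM] := leP M `|x|; first by rewrite gs// normr0.
  by rewrite (le_trans (gC _ _)) ?ler_norm// -ler_norml ltW.
- move=> x; rewrite -ler_norml; apply: contraR; rewrite -ltNge => /ltW xM.
  by rewrite gs// mulr0.
Qed.

(** What the one-dimensional computations use of a test function phi: the smooth
    compactly supported function eta = ray 1 phi of xi, its derivative
    eta' = ray id (Dx phi), and the density ray id phi. *)
Record profile phi M : Prop := Profile {
  profile_gt0 : 0 < M;
  eta_derive : forall xi : R,
    is_derive xi 1 (ray (cst 1) phi) (ray id (Dx phi) xi);
  eta'_continuous : continuous (ray id (Dx phi));
  mass_continuous : continuous (ray id phi);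
  dt_continuous : continuous (ray id (Dt phi));
  eta_support : forall xi, M <= `|xi| -> ray (cst 1) phi xi = 0;
  eta'_support : forall xi, M <= `|xi| -> ray id (Dx phi) xi = 0;
  mass_support : forall xi, M <= `|xi| -> ray id phi xi = 0;
  dt_support : forall xi, M <= `|xi| -> ray id (Dt phi) xi = 0;
  dt_ray : forall xi, ray id (Dt phi) xi =
    - ray (cst 1) phi xi - xi * ray id (Dx phi) xi }.

Lemma test_profile phi : test_function phi ->
  exists2 M0, 0 < M0 & forall M, M0 <= M -> profile phi M.
Proof.
move=> tphi; have [sphi _ _] := tphi.
have [dx dt] := smooth_derivable sphi.
have [A [c [d tb]]] := test_function_box tphi.
have [c0 cd bp bx bt] := tb.
have cid : continuous (id : R -> R) by move=> s; exact: cvg_id.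
exists (`|A / c| + 1) => [|M AM]; first by rewrite ltr_wpDl.
have Axi xi : M <= `|xi| -> A / c <= `|xi|.
  move=> h; apply: le_trans h; apply: le_trans AM.
  by rewrite (le_trans (ler_norm _))// lerDl.
split.
- by apply: lt_le_trans AM; rewrite ltr_wpDl.
- by move=> xi; exact: (is_derive_eta xi dx tb).
- exact: continuous_ray c0 bx cid.
- exact: continuous_ray c0 bp cid.
- exact: continuous_ray c0 bt cid.
- by move=> xi /Axi; exact: (ray_support _ c0 bp).
- by move=> xi /Axi; exact: (ray_support _ c0 bx).
- by move=> xi /Axi; exact: (ray_support _ c0 bp).
- by move=> xi /Axi; exact: (ray_support _ c0 bt).
- by move=> xi; exact: (ray_Dt xi dx dt tb).
Qed.

Lemma regular_distr_ray F W phi :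
  test_function phi -> bounded_measurable W ->
  (forall p, half_plane p -> F p = W (p.1 / p.2)) ->
  regular_distr F phi = \int[leb]_xi (W xi * ray id phi xi).
Proof.
move=> tphi bW FW; have [A [c [d [c0 _ bp _ _]]]] := test_function_box tphi.
exact: regular_distr_polar bp FW.
Qed.

(** The integrand K eta' - W eta, where K = G - xi W, to which the equation
    W_t + G_x = 0 reduces. *)
Definition balance W G phi xi :=
  (G xi - xi * W xi) * ray id (Dx phi) xi - W xi * ray (cst 1) phi xi.

Lemma balance_split W G phi M : profile phi M -> balance W G phi =
  fun xi => W xi * ray id (Dt phi) xi + G xi * ray id (Dx phi) xi.
Proof.
by move=> pr; apply/funext => xi; rewrite (dt_ray pr) /balance; ring.
Qed.

Lemma integrable_balance W G phi M : profile phi M ->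
  bounded_measurable W -> bounded_measurable G ->
  leb.-integrable setT (EFin \o balance W G phi).
Proof.
move=> pr bW bG; rewrite (balance_split _ _ pr).
have -> : EFin \o (fun xi => W xi * ray id (Dt phi) xi + G xi * ray id (Dx phi) xi)
  = (EFin \o (fun xi => W xi * ray id (Dt phi) xi)) \+
    (EFin \o (fun xi => G xi * ray id (Dx phi) xi)) by [].
apply: integrableD => //; apply: integrable_bounded_compact.
- by [].
- exact: dt_continuous pr.
- exact: dt_support pr.
- by [].
- exact: eta'_continuous pr.
- exact: eta'_support pr.
Qed.

Lemma conservation_ray F W H G phi :
  test_function phi -> bounded_measurable W -> bounded_measurable G ->
  (forall p, half_plane p -> F p = W (p.1 / p.2)) ->
  (forall p, half_plane p -> H p = G (p.1 / p.2)) ->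
  regular_distr F (Dt phi) + regular_distr H (Dx phi) =
  \int[leb]_xi balance W G phi xi.
Proof.
move=> tphi bW bG FW HG; have [A [c [d [c0 _ _ bx bt]]]] := test_function_box tphi.
have [M0 M00 /(_ _ (lexx _)) pr] := test_profile tphi.
rewrite (regular_distr_polar c0 bW bt FW) (regular_distr_polar c0 bG bx HG).
rewrite (balance_split _ _ pr) RintegralD//.
- apply: integrable_bounded_compact => //; first exact: dt_continuous pr.
  exact: dt_support pr.
- apply: integrable_bounded_compact => //; first exact: eta'_continuous pr.
  exact: eta'_support pr.
Qed.

Lemma Rintegral_chain (n : R -> R) a m b : a <= m -> m <= b ->
  leb.-integrable setT (EFin \o n) ->
  \int[leb]_(x in `[a, b]) n x =
  \int[leb]_(x in `[a, m]) n x + \int[leb]_(x in `[m, b]) n x.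
Proof.
move=> am mb inn.
have i1 (i : interval R) : leb.-integrable [set` i] (EFin \o n).
  exact: integrableS inn.
apply/eqP; rewrite addrC -subr_eq; apply/eqP.
by rewrite Rintegral_itvB//; exact: Rintegral_itv_obnd_cbnd.
Qed.

(** Where K = G0 - xi W0 is a primitive of - W0, the integrand is (K eta)', so
    that only boundary terms remain.  The values of W and G at the ends p and q
    are free: this is where the jumps are. *)
Lemma balance_piece W G W0 G0 phi M p q : profile phi M ->
  bounded_measurable W -> bounded_measurable G -> p <= q ->
  continuous W0 ->
  (forall xi : R, is_derive xi 1 (fun xi => G0 xi - xi * W0 xi) (- W0 xi)) ->
  (forall xi, p < xi < q -> W xi = W0 xi /\ G xi = G0 xi) ->
  \int[leb]_(xi in `[p, q]) balance W G phi xi =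
  (G0 q - q * W0 q) * ray (cst 1) phi q - (G0 p - p * W0 p) * ray (cst 1) phi p.
Proof.
move=> pr bW bG pq cW0 dK WG.
pose N xi := (G0 xi - xi * W0 xi) * ray (cst 1) phi xi.
have dN (xi : R) : is_derive xi 1 N (balance W0 G0 phi xi).
  have -> : N = (fun xi => G0 xi - xi * W0 xi) * ray (cst 1) phi by [].
  apply: is_derive_eq; first exact: is_deriveM (dK xi) (eta_derive pr xi).
  by rewrite /balance /GRing.scale/=; ring.
have cb : continuous (balance W0 G0 phi).
  move=> xi; apply: cvgB; apply: cvgM.
  - exact: is_derive_continuous dK _.
  - exact: eta'_continuous pr _.
  - exact: cW0.
  - exact: is_derive_continuous (eta_derive pr) _.
have ib := integrable_balance pr bW bG.
have ib0 (i : interval R) : leb.-integrable [set` i] (EFin \o balance W G phi).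
  exact: integrableS ib.
have ic : leb.-integrable `[p, q] (EFin \o balance W0 G0 phi).
  exact: continuous_integrable_segment.
rewrite -[RHS]/(N q - N p).
rewrite -(FTC_segment pq (continuous_subspaceT cb)
  (continuous_subspaceT (is_derive_continuous dN)) (fun xi _ => dN xi)).
have op h : leb.-integrable `[p, q] (EFin \o h) ->
    \int[leb]_(x in `]p, q[) h x = \int[leb]_(x in `[p, q]) h x.
  move=> ih; rewrite Rintegral_itv_bndo_bndc ?Rintegral_itv_obnd_cbnd//.
    by apply: integrableS ih => //; exact: subset_itv_oc_cc.
  by apply: integrableS ih => //; exact: subset_itv_oo_cc.
rewrite -!op//; apply: eq_Rintegral => x /set_mem; rewrite /= in_itv/= => xpq.
by rewrite /balance; have [-> ->] := WG _ xpq.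
Qed.

Lemma Rintegral_balance_segment W G phi M : profile phi M ->
  \int[leb]_xi balance W G phi xi = \int[leb]_(xi in `[- M, M]) balance W G phi xi.
Proof.
move=> pr; rewrite (@Rintegral_support _ _ _ leb [set` `[- M, M]])// => xi.
rewrite /= in_itv/= -ler_norml; apply: contraR; rewrite -ltNge => /ltW xM.
by rewrite /balance (eta'_support pr)// (eta_support pr)// !mulr0 subr0.
Qed.

End Profiles.

(** * Bounded measurable profiles and step functions *)

Section BoundedMeasurable.
Context {R : realType}.
Notation leb := (@lebesgue_measure R).
Implicit Types (W G : R -> R).

Lemma bm_cst (k : R) : bounded_measurable (fun=> k).
Proof. by split; [exact: measurable_cst|exists `|k|]. Qed.

Lemma bmD W G : bounded_measurable W -> bounded_measurable G ->
  bounded_measurable (fun x => W x + G x).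
Proof.
move=> [mW [B WB]] [mG [C GC]]; split; first exact: measurable_funD.
by exists (B + C) => x; rewrite (le_trans (ler_normD _ _))// lerD.
Qed.

Lemma bmM W G : bounded_measurable W -> bounded_measurable G ->
  bounded_measurable (fun x => W x * G x).
Proof.
move=> [mW [B WB]] [mG [C GC]]; split; first exact: measurable_funM.
by exists (B * C) => x; rewrite normrM ler_pM.
Qed.

Lemma bm_ifT (c : R -> bool) W G : measurable_fun setT (c : measurableTypeR R -> bool) ->
  (exists B, forall x, c x -> `|W x| <= B) -> 
  measurable_fun setT (W : measurableTypeR R -> measurableTypeR R) ->
  bounded_measurable G ->
  bounded_measurable (fun x => if c x then W x else G x).
Proof.
move=> mc [B WB] mW [mG [C GC]]; split; first exact: measurable_fun_ifT.
exists (`|B| + `|C|) => x; case: ifPn => cx.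
  by rewrite (le_trans (WB _ cx))// (le_trans (ler_norm _))// lerDl.
by rewrite (le_trans (GC _))// (le_trans (ler_norm _))// lerDr.
Qed.

Lemma bm_split_lt (a : R) W G : bounded_measurable W -> bounded_measurable G ->
  bounded_measurable (fun x => if x < a then W x else G x).
Proof.
move=> [mW [B WB]] bG; apply: bm_ifT => //; last by exists B.
exact: measurable_fun_ltr.
Qed.

Lemma bm_point (a k : R) W : bounded_measurable W ->
  bounded_measurable (fun x => if x == a then k else W x).
Proof.
move=> bG; apply: bm_ifT => //; last by exists `|k|.
exact: measurable_fun_eqr.
Qed.

Lemma bm_off2 (a b : R) W G : bounded_measurable W ->
  (forall x, x != a -> x != b -> G x = W x) -> bounded_measurable G.
Proof.
move=> bW GW.
have -> : G = fun x => if x == a then G a else if x == b then G b else W x.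
  apply/funext => x; case: eqVneq => [->//|xa]; case: eqVneq => [->//|xb].
  exact: GW.
by do 2 apply: bm_point.
Qed.

Lemma Rintegral_off2 (a b : R) (n n' : R -> R) :
  leb.-integrable setT (EFin \o n) -> leb.-integrable setT (EFin \o n') ->
  (forall x, x != a -> x != b -> n x = n' x) ->
  \int[leb]_x n x = \int[leb]_x n' x.
Proof.
move=> i1 i2 nn; rewrite /Rintegral; congr fine.
apply: ae_eq_integral => //; [exact: measurable_int i1|exact: measurable_int i2|].
exists ([set a] `|` [set b]); split.
- exact: measurableU.
- apply/eqP; rewrite -measure_le0.
  rewrite (le_trans (measureU2 _ _ _))//.
  by rewrite [X in (X + _)%E]lebesgue_measure_set1 add0e [leLHS]lebesgue_measure_set1.
- move=> x /= nx; apply: contrapT => ab; apply: nx => _; congr EFin; apply: nn.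
    by apply: contra_not_neq ab => ->; left.
  by apply: contra_not_neq ab => ->; right.
Qed.

(** The truncation of x to [l, r], written with the comparisons of the
    limit function fan_u. *)
Definition clamp (l r x : R) : R := if x < l then l else if x < r then x else r.

Lemma clamp_bound l r x : l <= r -> l <= clamp l r x <= r.
Proof. by move=> lr; rewrite /clamp; case: ltP => h1; [|case: ltP => h2]; lra. Qed.

Lemma clamp_norm l r x : l <= r -> `|clamp l r x| <= `|l| + `|r|.
Proof.
move=> lr; have := clamp_bound x lr.
have := ler_norm l; have := ler_norm r; have := ler_norm (- l).
have := ler_norm (- r); rewrite !normrN ler_norml; lra.
Qed.

Lemma clamp_dist l r x y : l <= r -> `|clamp l r x - clamp l r y| <= `|x - y|.
Proof.
move=> lr; rewrite ler_norml; have := ler_norm (x - y).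
have := ler_norm (- (x - y)); rewrite normrN /clamp.
by case: ltP => h1; [|case: ltP => h2]; (case: ltP => h3; [|case: ltP => h4]); lra.
Qed.

Lemma clamp_continuous l r : l <= r -> continuous (clamp l r).
Proof.
move=> lr x; apply/cvgrPdist_le => e e0; near=> y.
apply: le_trans (clamp_dist _ _ lr) _; near: y.
by apply: (@cvgr_dist_le _ _ _ _ _ id x) => //; exact: cvg_id.
Unshelve. all: by end_near. Qed.

End BoundedMeasurable.

Section WeakSolutions.
Context {R : realType}.
Notation leb := (@lebesgue_measure R).
Implicit Types (W G : R -> R) (f phi : R * R -> R).

Definition selfsimilar W f := forall p, half_plane p -> f p = W (p.1 / p.2).

Lemma selfsimilar_loc_integrable W f : bounded_measurable W ->
  selfsimilar W f -> loc_integrable f.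
Proof.
move=> [mW [B WB]] fW K cK Kh; have mK := compact_measurable_plane cK.
have Kfin : (lebesgue2 K < +oo)%E.
  have [M [_ MP]] := compact_bounded cK.
  have MA : M < `|M| + 1 by rewrite (le_lt_trans (ler_norm M))// ltrDl.
  pose I := [set` `[- (`|M| + 1), `|M| + 1]].
  apply: (@le_lt_trans _ _ (lebesgue2 (I `*` I))).
    have mI : measurable (I `*` I : set (measurableTypeR R * measurableTypeR R)).
      by apply: measurableX; exact: measurable_itv.
    apply: le_measure; rewrite ?inE//.
    move=> p Kp; have := MP _ MA p Kp.
    rewrite /= prod_normE ge_max => /andP[h1 h2].
    by split; rewrite /I/= in_itv/= -ler_norml.
  have -> : lebesgue2 (I `*` I) = (leb I * leb I)%E 
    by apply: product_measure1E; exact: measurable_itv.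
  by rewrite /I !lebesgue_measure_itv/=; case: ifP => _;
    rewrite ?mul0e -?EFinB -?EFinM ?ltry.
apply: measurable_bounded_integrable => //.
  have m1 : measurable_fun K ((fun p => W (p.1 / p.2)) :
      measurableTypeR R * measurableTypeR R -> measurableTypeR R).
    apply: measurable_funTS.
    exact: (measurableT_comp mW measurable_fun_ratio).
  by apply: eq_measurable_fun m1 => p /set_mem /Kh hp; rewrite fW.
exists B; split; first exact: num_real.
by move=> M BM p Kp /=; rewrite fW ?(le_trans (WB _))// ?ltW//; exact: Kh.
Qed.

Lemma bm_flux eps W : bounded_measurable W ->
  bounded_measurable (fun x => flux_u eps (W x)).
Proof.
move=> bW; rewrite /flux_u; apply: bmM; last exact: bm_cst.
have b := bmD bW (bm_cst eps).
have -> : (fun x => (W x + eps) ^+ 2) = (fun x => (W x + eps) * (W x + eps)).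
  by apply/funext => x; rewrite expr2.
exact: bmM.
Qed.

Definition step_profile (s a c b xi : R) : R :=
  if xi < s then a else if xi == s then c else b.

Lemma selfsimilar_step s a c b : selfsimilar (step_profile s a c b) (step s a c b).
Proof.
move=> [x t]; rewrite /half_plane/= => t0; rewrite /step /step_profile/=.
rewrite ltr_pdivrMr//; suff -> : (x == s * t) = (x / t == s) by [].
apply/eqP/eqP => [->|<-]; first by rewrite mulfK// lt0r_neq0.
by rewrite divfK// lt0r_neq0.
Qed.

Lemma bm_step s a c b : bounded_measurable (step_profile s a c b).
Proof. by apply: bm_split_lt; [exact: bm_cst|apply: bm_point; exact: bm_cst]. Qed.

Lemma is_derive_affine (g w xi : R) :
  is_derive xi 1 (fun xi : R => g - xi * w) (- w).
Proof.
have -> : (fun xi : R => g - xi * w) = cst g - w \*: id.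
  by apply/funext => y /=; rewrite !fctE/= mulrC.
by apply: is_derive_eq; rewrite /GRing.scale/= mulr1 sub0r.
Qed.

(** The coefficient is the Rankine-Hugoniot deficit of the step. *)
Lemma conservation_step s a c b fa fc fb phi : test_function phi ->
  regular_distr (step s a c b) (Dt phi) + regular_distr (step s fa fc fb) (Dx phi) =
  ((fa - fb) - s * (a - b)) * ray (cst 1) phi s.
Proof.
move=> tphi; have [M0 M00 Mpr] := test_profile tphi.
pose M := Num.max M0 (`|s| + 1).
have pr : profile phi M by apply: Mpr; rewrite le_max lexx.
have sM : - M <= s <= M.
  by rewrite -ler_norml le_max; apply/orP; right; rewrite lerDl.
have [b1 b2] := (bm_step s a c b, bm_step s fa fc fb).
rewrite (conservation_ray tphi b1 b2 (selfsimilar_step _ _ _ _) (selfsimilar_step _ _ _ _)).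
rewrite (Rintegral_balance_segment _ _ pr).
case/andP: sM => sM1 sM2; rewrite (Rintegral_chain sM1 sM2);
  last exact: integrable_balance pr b1 b2.
have ccst (k : R) : continuous ((fun=> k) : R -> R).
  by move=> xi; exact: cst_continuous.
rewrite (@balance_piece _ _ _ (fun=> a) (fun=> fa) _ _ _ _ pr b1 b2 sM1 (ccst _)
  (is_derive_affine fa a)); last first.
  by move=> xi /andP[_ xs]; rewrite /step_profile xs.
rewrite (@balance_piece _ _ _ (fun=> b) (fun=> fb) _ _ _ _ pr b1 b2 sM2 (ccst _)
  (is_derive_affine fb b)); last first.
  move=> xi /andP[xs _]; rewrite /step_profile ltNge (ltW xs)/=.
  by rewrite gt_eqF.
have M0' : 0 < M by exact: profile_gt0 pr.
rewrite (eta_support pr (xi := M)) ?gtr0_norm//.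
rewrite (eta_support pr (xi := - M)) ?normrN ?gtr0_norm// !mulr0.
by move: (ray _ _ _) => e; clear; ring.
Qed.

End WeakSolutions.

(** * The fan satisfies both conservation laws *)

Section Fan.
Context {R : realType}.
Variables (eps ul ur rl rr : R).
Hypotheses (e0 : 0 < eps) (lr : ul <= ur).
Notation leb := (@lebesgue_measure R).
Implicit Types (phi : R * R -> R).

(** The whole velocity fan: on the rarefaction wave lambda_2 = u + eps is xi, and
    u is constant on either side. *)
Definition fan_U (xi : R) : R := clamp ul ur (xi - eps).
(** The density is constant where the velocity is, and an exponential in the
    rarefaction wave; beyond the contact discontinuity xi = ul, both are captured
    by this function of the velocity, since d rho / d u = rho / eps along the
    2-wave.  For ul = ur it is the step from rl to rr. *)
Definition fan_P (xi : R) : R :=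
  if xi < ul then rl else rr * expR ((fan_U xi - ur) / eps).

Lemma fan_U_left xi : xi < ul + eps -> fan_U xi = ul.
Proof. by rewrite -ltrBlDr /fan_U /clamp => ->. Qed.

Lemma fan_U_mid xi : ul + eps <= xi <= ur + eps -> fan_U xi = xi - eps.
Proof.
move=> h; rewrite /fan_U /clamp; case: ltP => h1; first by lra.
by case: ltP => h2 //; lra.
Qed.

Lemma fan_U_right xi : ur + eps <= xi -> fan_U xi = ur.
Proof.
move: lr => lr' h; rewrite /fan_U /clamp; case: ltP => h1; first by lra.
by case: ltP => h2 //; lra.
Qed.

Definition wave (xi : R) : R := rr * expR ((xi - (ur + eps)) / eps).

Lemma fan_P_left xi : xi < ul -> fan_P xi = rl.
Proof. by rewrite /fan_P => ->. Qed.

Lemma fan_P_right xi : ul <= xi -> fan_P xi = rr * expR ((fan_U xi - ur) / eps).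
Proof. by rewrite /fan_P leNgt => /negbTE ->. Qed.

Lemma fan_P_mid xi : ul + eps <= xi <= ur + eps -> fan_P xi = wave xi.
Proof.
move=> h; rewrite fan_P_right; last by move: e0; lra.
rewrite (fan_U_mid h) /wave.
by have -> : xi - eps - ur = xi - (ur + eps) by ring.
Qed.

Lemma fan_U_continuous : continuous fan_U.
Proof.
move=> x; apply: (@continuous_comp _ _ _ (fun xi => xi - eps) (clamp ul ur)).
  by apply: cvgB; [exact: cvg_id|exact: cvg_cst].
exact: clamp_continuous.
Qed.

Lemma bm_fan_U : bounded_measurable fan_U.
Proof.
split; first by apply: continuous_measurable_fun; exact: fan_U_continuous.
by exists (`|ul| + `|ur|) => x; exact: clamp_norm.
Qed.

Lemma fan_exp_continuous :
  continuous (fun xi => rr * expR ((fan_U xi - ur) / eps)).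
Proof.
move=> x; apply: cvgM; first exact: cvg_cst.
apply: (@continuous_comp _ _ _ (fun xi => (fan_U xi - ur) / eps) expR).
  apply: cvgM; last exact: cvg_cst.
  by apply: cvgB; [exact: fan_U_continuous|exact: cvg_cst].
exact: continuous_expR.
Qed.

Lemma fan_P_bound xi : `|fan_P xi| <= `|rl| + `|rr|.
Proof.
rewrite /fan_P; case: ifP => _; first by rewrite lerDl.
rewrite normrM (le_trans (y := `|rr|))// ?lerDr//.
rewrite ler_piMr// ger0_norm ?expR_ge0// expR_le1.
rewrite pmulr_lle0 ?invr_gt0// subr_le0.
by have /andP[] := clamp_bound (xi - eps) lr.
Qed.

Lemma bm_fan_P : bounded_measurable fan_P.
Proof.
split; last by exists (`|rl| + `|rr|) => x; exact: fan_P_bound.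
apply: measurable_fun_ifT; first exact: measurable_fun_ltr.
  exact: measurable_cst.
by apply: continuous_measurable_fun; exact: fan_exp_continuous.
Qed.

Lemma is_derive_wave (xi : R) : is_derive xi 1 wave (wave xi / eps).
Proof.
have h : is_derive xi 1 (fun xi : R => (xi - (ur + eps)) / eps) (eps^-1).
  have -> : (fun xi : R => (xi - (ur + eps)) / eps) =
      (fun xi => (- (ur + eps) / eps) - xi * (- eps^-1)).
    by apply/funext => y; field; exact: lt0r_neq0.
  by rewrite -[X in is_derive _ _ _ X]opprK; exact: is_derive_affine.
have h2 := @is_derive1_comp _ expR _ _ _ _ (is_derive_expR _) h.
have -> : wave = rr \*: (expR \o (fun xi : R => (xi - (ur + eps)) / eps)) by [].
by apply: is_derive_eq; rewrite /wave /GRing.scale/= mulrA.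
Qed.

(** At both ends of the rarefaction wave K = flux_u u - xi u is continuous, so
    the boundary terms of the three pieces cancel. *)
Lemma fan_U_conservation phi : test_function phi ->
  \int[leb]_xi balance fan_U (fun xi => flux_u eps (fan_U xi)) phi xi = 0.
Proof.
move=> tphi; have [M0 M00 Mpr] := test_profile tphi.
(* [- M, M] contains the support of eta and the breakpoints of the fan. *)
pose M := Num.max M0 (`|ul + eps| + `|ur + eps|).
have pr : profile phi M by apply: Mpr; rewrite le_max lexx.
have M0' : 0 < M by exact: profile_gt0 pr.
have MM : `|ul + eps| + `|ur + eps| <= M by rewrite le_max lexx orbT.
have h1 : - M <= ul + eps.
  have := ler_norm (- (ul + eps)); have := normr_ge0 (ur + eps); rewrite normrN; lra.
have h2 : ul + eps <= ur + eps by rewrite lerD2r.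
have h3 : ur + eps <= M.
  have := ler_norm (ur + eps); have := normr_ge0 (ul + eps); lra.
have [b1 b2] := (bm_fan_U, bm_flux eps bm_fan_U).
have ccst (k : R) : continuous ((fun=> k) : R -> R).
  by move=> xi; exact: cst_continuous.
have ib := integrable_balance pr b1 b2.
rewrite (Rintegral_balance_segment _ _ pr).
rewrite (Rintegral_chain h1 (le_trans h2 h3) ib) (Rintegral_chain h2 h3 ib).
rewrite (@balance_piece _ _ _ (fun=> ul) (fun=> flux_u eps ul) _ _ _ _ pr b1 b2 h1 (ccst _)
  (is_derive_affine _ _)); last first.
  by move=> xi /andP[_ xs]; rewrite fan_U_left.
rewrite (@balance_piece _ _ _ (fun=> ur) (fun=> flux_u eps ur) _ _ _ _ pr b1 b2 h3 (ccst _)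
  (is_derive_affine _ _)); last first.
  by move=> xi /andP[xs _]; rewrite fan_U_right// ltW.
have cW : continuous (fun xi : R => xi - eps).
  by move=> x; apply: cvgB; [exact: cvg_id|exact: cvg_cst].
have dK (xi : R) : is_derive xi 1
    (fun xi : R => flux_u eps (xi - eps) - xi * (xi - eps)) (- (xi - eps)).
  have -> : (fun xi : R => flux_u eps (xi - eps) - xi * (xi - eps)) =
      eps \*: id - 2^-1 \*: (id * id).
    by apply/funext => y; rewrite /flux_u !fctE/= /GRing.scale/=; field.
  by apply: is_derive_eq; rewrite /GRing.scale/=; field.
rewrite (@balance_piece _ _ _ _ (fun xi => flux_u eps (xi - eps)) _ _ _ _ pr b1 b2 h2 cW dK);
  last first.
  by move=> xi /andP[x1 x2]; rewrite fan_U_mid// !ltW.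
rewrite (eta_support pr (xi := M)) ?gtr0_norm//.
rewrite (eta_support pr (xi := - M)) ?normrN ?gtr0_norm// !mulr0.
move: (ray _ _ (ul + eps)) (ray _ _ (ur + eps)) => x y; rewrite /flux_u; by field.
Qed.

(** Here K = rho (u - xi).  It vanishes from both sides at the contact
    discontinuity, where xi = ul = u, and equals - eps rho in the rarefaction
    wave, where d rho / d xi = rho / eps makes - rho its derivative. *)
Lemma fan_P_conservation phi : test_function phi ->
  \int[leb]_xi balance fan_P (fun xi => fan_P xi * fan_U xi) phi xi = 0.
Proof.
move=> tphi; have [M0 M00 Mpr] := test_profile tphi.
pose M := Num.max M0 (`|ul| + `|ul + eps| + `|ur + eps|).
have pr : profile phi M by apply: Mpr; rewrite le_max lexx.
have M0' : 0 < M by exact: profile_gt0 pr.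
have MM : `|ul| + `|ul + eps| + `|ur + eps| <= M by rewrite le_max lexx orbT.
have h0 : - M <= ul.
  have := ler_norm (- ul); have := normr_ge0 (ul + eps).
  have := normr_ge0 (ur + eps); rewrite normrN; lra.
have h1 : ul <= ul + eps by rewrite lerDl ltW.
have h2 : ul + eps <= ur + eps by rewrite lerD2r.
have h3 : ur + eps <= M.
  have := ler_norm (ur + eps); have := normr_ge0 ul.
  have := normr_ge0 (ul + eps); lra.
have [b1 b2] := (bm_fan_P, bmM bm_fan_P bm_fan_U).
have ccst (k : R) : continuous ((fun=> k) : R -> R).
  by move=> xi; exact: cst_continuous.
have ib := integrable_balance pr b1 b2.
pose rm := rr * expR ((ul - ur) / eps).
rewrite (Rintegral_balance_segment _ _ pr).
rewrite (Rintegral_chain h0 (le_trans h1 (le_trans h2 h3)) ib).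
rewrite (Rintegral_chain h1 (le_trans h2 h3) ib) (Rintegral_chain h2 h3 ib).
rewrite (@balance_piece _ _ _ (fun=> rl) (fun=> rl * ul) _ _ _ _ pr b1 b2 h0 (ccst _)
  (is_derive_affine _ _)); last first.
  move=> xi /andP[_ xs]; rewrite fan_P_left// fan_U_left//.
  exact: lt_le_trans xs h1.
rewrite (@balance_piece _ _ _ (fun=> rm) (fun=> rm * ul) _ _ _ _ pr b1 b2 h1 (ccst _)
  (is_derive_affine _ _)); last first.
  by move=> xi /andP[x1 x2]; rewrite fan_P_right ?ltW// fan_U_left.
rewrite (@balance_piece _ _ _ (fun=> rr) (fun=> rr * ur) _ _ _ _ pr b1 b2 h3 (ccst _)
  (is_derive_affine _ _)); last first.
  move=> xi /andP[xs _]; have xr := ltW xs.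
  by rewrite fan_P_right ?(le_trans h1 (le_trans h2 xr))// fan_U_right// subrr mul0r expR0 mulr1.
have dK (xi : R) : is_derive xi 1
    (fun xi : R => wave xi * (xi - eps) - xi * wave xi) (- wave xi).
  have -> : (fun xi : R => wave xi * (xi - eps) - xi * wave xi) = - eps \*: wave.
    by apply/funext => y; rewrite /= /GRing.scale/=; ring.
  have := is_derive_wave xi => dw; apply: is_derive_eq.
  by rewrite /GRing.scale/=; field; exact: lt0r_neq0.
rewrite (@balance_piece _ _ _ wave (fun xi => wave xi * (xi - eps)) _ _ _ _ pr b1 b2 h2
  (is_derive_continuous is_derive_wave) dK); last first.
  by move=> xi /andP[x1 x2]; rewrite fan_P_mid ?fan_U_mid// !ltW.
have -> : wave (ul + eps) = rm.
  rewrite /wave /rm.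
  by have -> : ul + eps - (ur + eps) = ul - ur by ring.
have -> : wave (ur + eps) = rr by rewrite /wave subrr mul0r expR0 mulr1.
rewrite (eta_support pr (xi := M)) ?gtr0_norm//.
rewrite (eta_support pr (xi := - M)) ?normrN ?gtr0_norm// !mulr0.
move: (ray _ _ (ul + eps)) (ray _ _ (ur + eps)) (ray _ _ ul) rm => x y z r; ring.
Qed.

End Fan.

(** * Existence of the Lax solution *)

Section LaxSolutions.
Context {R : realType}.
Variables (eps ul ur rl rr : R).
Hypotheses (e0 : 0 < eps) (lr : ul <= ur).
Notation leb := (@lebesgue_measure R).

Let U := fan_U eps ul ur.
Let P := fan_P eps ul ur rl rr.

Lemma fan_P_continuous_right xi : ul < xi -> {for xi, continuous P}.
Proof.
move=> xi_ul.
pose E xi : R := rr * expR ((U xi - ur) / eps).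
have cE : continuous E by exact: fan_exp_continuous.
rewrite /prop_for /continuous_at.
have -> : P xi = E xi by rewrite /P fan_P_right// ltW.
apply: cvg_trans (cE xi); apply: near_eq_cvg; near=> y.
rewrite /P fan_P_right//.
suff : ul < y by exact: ltW.
near: y; exact: lt_nbhsr.
Unshelve. all: by end_near. Qed.

Lemma lax_fan_canonical : lax_fan eps (ul, rl) (ur, rr) U P.
Proof.
(* For ul = ur the 2-wave is trivial and is placed on the contact line. *)
have [lt|ge] := ltP ul ur; last first.
  have E : ul = ur by apply/eqP; rewrite eq_le lr ge.
  exists (ur, rr), ul, ul, ul; split.
    by split; [split|apply: TwoTrivial|exact: lexx].
  have UE xi : U xi = ur.
    have := clamp_bound (xi - eps) lr; rewrite -/(fan_U eps ul ur xi) -/(U xi).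
    by move: E; lra.
  split => xi xis.
  - by rewrite UE /P fan_P_left // E.
  - by move: xis => /andP[] /lt_trans h /h; rewrite ltxx.
  - by rewrite /P fan_P_right ?ltW// -/U UE subrr mul0r expR0 mulr1.
pose rm := rr * expR ((ul - ur) / eps).
have ab : ul + eps < ur + eps by rewrite ltrD2r.
exists (ul, rm), ul, (ul + eps), (ur + eps); split.
  split; [by split| |by rewrite lerDl ltW].
  have Pa : P (ul + eps) = rm.
    rewrite /P fan_P_right ?lerDl ?ltW// fan_U_mid ?lexx ?ltW//.
    by rewrite /rm addrK.
  have Pb : P (ur + eps) = rr.
    rewrite /P fan_P_right ?fan_U_right//; last by move: e0 lt; lra.
    by rewrite subrr mul0r expR0 mulr1.
  have Ua : U (ul + eps) = ul.
    by rewrite /U fan_U_mid ?lexx ?ltW// addrK.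
  have Ub : U (ur + eps) = ur by rewrite /U fan_U_right.
  apply: TwoRarefaction.
  - by split.
  - split.
    + by apply: continuous_subspaceT; exact: fan_U_continuous.
    + apply: continuous_in_subspaceT => x /set_mem; rewrite /= in_itv/= => /andP[ax _].
      by apply: fan_P_continuous_right; apply: lt_le_trans ax; rewrite ltrDl.
    + by rewrite Ua Pa.
    + by rewrite Ub Pb.
  - move=> xi /andP[x1 x2].
    have nearab : \forall y \near xi, ul + eps <= y <= ur + eps.
      near=> y; apply/andP; split; apply: ltW; near: y; [exact: lt_nbhsr|exact: lt_nbhsl].
    split.
    + by rewrite /lambda2/= /U fan_U_mid ?subrK// !ltW.
    + apply: (@near_eq_is_derive _ _ _ (fun y => y - eps)).
        by near=> y; rewrite /U fan_U_mid//; near: y.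
      have -> : (fun y : R => y - eps) = (fun y => - eps - y * -1).
        by apply/funext => y; ring.
      by rewrite -[X in is_derive _ _ _ X]opprK; exact: is_derive_affine.
    + have -> : P xi = wave eps ur rr xi by rewrite /P fan_P_mid// !ltW.
      apply: (@near_eq_is_derive _ _ _ (wave eps ur rr)).
        by near=> y; rewrite /P fan_P_mid//; near: y.
      exact: is_derive_wave.
split => xi xis.
- rewrite /P fan_P_left// /U fan_U_left//.
  by apply: lt_trans xis _; rewrite ltrDl.
- by move: xis => /andP[x1 x2]; rewrite /U /P fan_P_right ?fan_U_left// ltW.
- have xl : ul <= xi by move: e0 lt xis; lra.
  by rewrite /U /P fan_P_right// fan_U_right ?ltW// subrr mul0r expR0 mulr1.
Unshelve. all: by end_near. Qed.

(** For fixed x < 0, the ratio x / t tends to - oo as t decreases to 0, so that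
    the solution is eventually equal to the left state; likewise on the right. *)
Lemma selfsimilar_initial_value (W : R -> R) (a b fl fr : R) :
  (forall xi, xi < a -> W xi = fl) -> (forall xi, b < xi -> W xi = fr) ->
  initial_value (fun p => W (p.1 / p.2)) fl fr.
Proof.
move=> Wl Wr.
have small (k : R) : k * t @[t --> 0^'+] --> 0.
  rewrite -[X in _ --> X](mulr0 k); apply: cvg_at_right_filter.
  by apply: cvgM; [exact: cvg_cst|exact: cvg_id].
split => x x0; apply: cvg_near_cst; near=> t.
- apply: Wl => /=; rewrite ltr_pdivrMr; last by near: t; exact: nbhs_right_gt.
  by near: t; exact: (cvgr_gt _ (small a)).
- apply: Wr => /=; rewrite ltr_pdivlMr; last by near: t; exact: nbhs_right_gt.
  by near: t; exact: (cvgr_lt _ (small b)).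
Unshelve. all: by end_near. Qed.

Lemma lax_riemann_solution_exists :
  exists u rho : R * R -> R, lax_riemann_solution eps (ul, rl) (ur, rr) u rho.
Proof.
pose u (p : R * R) := U (p.1 / p.2); pose rho (p : R * R) := P (p.1 / p.2).
exists u, rho.
have bU : bounded_measurable U by exact: bm_fan_U.
have bP : bounded_measurable P by exact: bm_fan_P.
have bF := bm_flux eps bU.
have bM := bmM bP bU.
split.
- split.
    split.
    + exact: (@selfsimilar_loc_integrable _ U).
    + exact: (@selfsimilar_loc_integrable _ (fun x => flux_u eps (U x))).
    + exact: (@selfsimilar_loc_integrable _ P).
    + exact: (@selfsimilar_loc_integrable _ (fun x => P x * U x)).
  split => phi tphi.
  + rewrite (@conservation_ray _ _ U _ (fun x => flux_u eps (U x)))//.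
    exact: fan_U_conservation.
  + rewrite (@conservation_ray _ _ P _ (fun x => P x * U x))//.
    exact: fan_P_conservation.
- apply: (@selfsimilar_initial_value _ ul (ur + eps)) => xi h.
  + by rewrite /U fan_U_left//; apply: lt_trans h _; rewrite ltrDl.
  + by rewrite /U fan_U_right// ltW.
- apply: (@selfsimilar_initial_value _ ul (ur + eps)) => xi h.
  + by rewrite /P fan_P_left.
  + have xl : ul <= xi by move: e0 lr h; lra.
    by rewrite /P fan_P_right// (fan_U_right lr (ltW h)) subrr mul0r expR0 mulr1.
- by exists U, P; split => //; exact: lax_fan_canonical.
Qed.

End LaxSolutions.

(** * Uniqueness of the Lax solution *)

Section Uniqueness.
Context {R : realType}.
Notation leb := (@lebesgue_measure R).

(** Profiles that differ at finitely many xi give functions that differ on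
    finitely many half-lines x = xi t. *)
Lemma ae_eq_selfsimilar (C : set R) (W1 W2 : R -> R) (f1 f2 : R * R -> R) :
  finite_set C -> (forall xi, ~ C xi -> W1 xi = W2 xi) ->
  selfsimilar W1 f1 -> selfsimilar W2 f2 -> ae_eq_half_plane f1 f2.
Proof.
move=> fC WW f1W f2W; have cC := finite_set_countable fC.
pose N : set (measurableTypeR R * measurableTypeR R) :=
  half_plane `&` (fun p => p.1 / p.2) @^-1` C.
have mC : measurable (C : set (measurableTypeR R)).
  by apply: countable_measurable => // t; exact: measurable_set1.
have mN : measurable N.
  apply: measurableI.
    apply: open_measurable_plane.
    rewrite (_ : half_plane = snd @^-1` [set x : R | 0 < x])//.
    apply: open_comp; last exact: open_gt.
    by move=> p _; exact: continuous_snd_plane.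
  by rewrite -[X in measurable X]setTI; exact: measurable_fun_ratio.
exists N; split => //; last first.
  move=> p /= np; apply: contrapT => nN; apply: np => hp.
  by rewrite f1W// f2W//; apply: WW => Cp; apply: nN.
have mi : measurable_fun setT
    ((fun p => (\1_N p)%:E) : measurableTypeR R * measurableTypeR R -> \bar R).
  by apply/measurable_EFinP; exact: measurable_indic.
rewrite -[N]setIT -(integral_indic lebesgue2 measurableT mN).
rewrite /lebesgue2 fubini_tonelli2//.
rewrite integral0_eq// => y _; rewrite /fubini_G.
pose S := [set x : R | N (x, y)].
have cS : countable S.
  apply: finite_set_countable.
  apply: (sub_finite_set (B := (fun c : R => c * y) @` C)); last exact: finite_image.
  move=> x [/= y0 Cx]; exists (x / y) => //.
  by rewrite divfK// lt0r_neq0.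
have mS : measurable (S : set (measurableTypeR R)).
  by apply: countable_measurable => // t; exact: measurable_set1.
transitivity (\int[leb]_x (\1_S x)%:E)%E.
  by apply: eq_integral => x _; rewrite !indicE.
by rewrite integral_indic// setIT; exact: countable_lebesgue_measure0.
Qed.

(** The function P exp(- x / eps) has zero derivative. *)
Lemma exponential_unique (eps a b : R) (P : R -> R) xi :
  {within `[a, b], continuous P} ->
  (forall x : R, a < x < b -> is_derive x 1 P (P x / eps)) ->
  a <= xi <= b -> P xi = P b * expR ((xi - b) / eps).
Proof.
move=> cP dP /andP[ax]; rewrite le_eqVlt => /predU1P[->|xb].
  by rewrite subrr mul0r expR0 mulr1.
pose E (x : R) := expR (- x / eps).
have dE (x : R) : is_derive x 1 E (- (E x / eps)).
  have h : is_derive x 1 (fun x : R => - x / eps) (- eps^-1).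
    have -> : (fun x : R => - x / eps) = (fun x => 0 - x * eps^-1).
      by apply/funext => y; rewrite sub0r mulNr.
    exact: is_derive_affine.
  have := @is_derive1_comp _ expR _ _ _ _ (is_derive_expR _) h.
  by rewrite mulrN.
have cE := is_derive_continuous dE.
have [| |c _] := @MVT _ (P * E) (cst 0) xi b xb.
- move=> c; rewrite in_itv/= => /andP[xc cb].
  have dPc : is_derive c 1 P (P c / eps) by apply: dP; rewrite cb (le_lt_trans ax).
  have := dE c => dEc; apply: is_derive_eq.
  by rewrite /GRing.scale/=; ring.
- have cPx : {within `[xi, b], continuous P}.
    apply: continuous_subspaceW cP => y; rewrite /= !in_itv/= => /andP[xy ->].
    by rewrite (le_trans ax).
  move=> y; apply: continuousM; first exact: cPx.
  exact: (continuous_subspaceT cE).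
rewrite mul0r => /eqP; rewrite subr_eq0 => /eqP PE.
have -> : expR ((xi - b) / eps) = E b / E xi.
  by rewrite /E -expRN -expRD; congr expR; rewrite mulrBl !mulNr opprK addrC.
have E0 : E xi != 0 by rewrite gt_eqF// expR_gt0.
by rewrite mulrA; apply: (canRL (mulfK E0)); exact/esym.
Qed.

Variables (eps ul ur rl rr : R).
Hypotheses (e0 : 0 < eps) (lr : ul <= ur).

(** A contact discontinuity does not change u, so s = ul.  If ul <= ur, the
    2-wave cannot be a shock; it is trivial only if ul = ur, and a rarefaction
    wave is determined by its differential equations and its right state.  The
    points ul and a are those where the profiles are left free. *)
Lemma lax_fan_unique U P : lax_fan eps (ul, rl) (ur, rr) U P ->
  exists a, forall xi, xi != ul -> xi != a ->
    U xi = fan_U eps ul ur xi /\ P xi = fan_P eps ul ur rl rr xi.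
Proof.
move=> [[um rm] [s [a [b [[[/= <- ->] tw sa] [lft mid rgt]]]]]].
rewrite /lambda1/= in sa lft mid *.
exists a => xi xul xa.
have [xl|] := ltP xi ul.
  have [-> ->] : U xi = ul /\ P xi = rl by have [] := lft xi xl.
  by rewrite fan_P_left// fan_U_left//; apply: lt_trans xl _; rewrite ltrDl.
rewrite le_eqVlt eq_sym (negbTE xul)/= => ulx.
have midE : xi < a -> U xi = ul /\ P xi = rm.
  by move=> xia; have := mid xi; rewrite ulx xia => /(_ isT)[].
have rgtE : b < xi -> U xi = ur /\ P xi = rr.
  by move=> bx; have := rgt xi bx => -[].
case: tw => [[E Er] ab|[/= aE bE ab] [cU cP [Ua Pa] [Ub Pb]] ode|s' _ _ _ _ /andP[/= h1 h2] _].
- have [-> ->] : U xi = ur /\ P xi = rr.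
    have [xia|ax|xE] := ltgtP xi a; last by rewrite xE eqxx in xa.
      by have [-> ->] := midE xia; rewrite E Er.
    by apply: rgtE; rewrite -ab.
  have UE : fan_U eps ul ur xi = ur.
    by have := clamp_bound (xi - eps) lr; rewrite -/(fan_U eps ul ur xi) E; lra.
  by rewrite fan_P_right ?ltW// UE subrr mul0r expR0 mulr1.
- rewrite /lambda2/= in aE bE.
  have inside x : a <= x <= b -> U x = x - eps.
    move=> /andP[]; rewrite le_eqVlt => /predU1P[<- _|ax]; first by rewrite Ua aE addrK.
    rewrite le_eqVlt => /predU1P[->|xb]; first by rewrite Ub bE addrK.
    have [|h _ _] := ode x; first by rewrite ax xb.
    by move: h; rewrite /lambda2/= => h; apply/eqP; rewrite eq_sym subr_eq h.
  have insideP x : a <= x <= b -> P x = wave eps ur rr x.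
    have dP (y : R) : a < y < b -> is_derive y 1 P (P y / eps).
      by move=> yab; have [] := ode y yab.
    by move=> xab; rewrite (exponential_unique cP dP xab) Pb bE.
  have [xia|ax] := ltP xi a.
    have [-> ->] := midE xia; rewrite fan_P_right ?ltW//.
    rewrite aE in xia; rewrite fan_U_left//; split => //.
    have := insideP a; rewrite lexx (ltW ab) Pa => /(_ isT) ->.
    rewrite /wave aE.
    by have -> : ul + eps - (ur + eps) = ul - ur by ring.
  have [xb|bx] := leP xi b.
    rewrite inside ?ax// insideP ?ax//.
    by rewrite fan_U_mid -?aE -?bE ?ax// fan_P_mid// -aE -bE ax.
  have [-> ->] := rgtE bx.
  rewrite bE in bx.
  by rewrite fan_P_right ?ltW// (fan_U_right lr (ltW bx)) subrr mul0r expR0 mulr1.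
- by exfalso; move: h1 h2 lr; rewrite /lambda2/=; lra.
Qed.

Lemma lax_riemann_solution_unique u1 rho1 u2 rho2 :
  lax_riemann_solution eps (ul, rl) (ur, rr) u1 rho1 ->
  lax_riemann_solution eps (ul, rl) (ur, rr) u2 rho2 ->
  ae_eq_half_plane u1 u2 /\ ae_eq_half_plane rho1 rho2.
Proof.
move=> [_ _ _ [U1 [P1 [/lax_fan_unique[a1 E1] S1]]]].
move=> [_ _ _ [U2 [P2 [/lax_fan_unique[a2 E2] S2]]]].
pose C : set R := [set ul] `|` [set a1] `|` [set a2].
have cC : finite_set C.
  by rewrite !finite_setU; split; [split|]; exact: finite_set1.
have off xi : ~ C xi -> [/\ xi != ul, xi != a1 & xi != a2].
  move=> nC; split; apply: contra_not_neq nC => ->; rewrite /C/=; tauto.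
split.
- apply: (ae_eq_selfsimilar (W1 := U1) (W2 := U2) cC).
  + by move=> xi /off[n0 n1 n2]; rewrite (E1 xi n0 n1).1 (E2 xi n0 n2).1.
  + by move=> p /S1[].
  + by move=> p /S2[].
- apply: (ae_eq_selfsimilar (W1 := P1) (W2 := P2) cC).
  + by move=> xi /off[n0 n1 n2]; rewrite (E1 xi n0 n1).2 (E2 xi n0 n2).2.
  + by move=> p /S1[].
  + by move=> p /S2[].
Qed.

End Uniqueness.

(** * Vanishing-epsilon limits of profiles *)

Section Convergence.
Context {R : realType}.
Notation leb := (@lebesgue_measure R).
Implicit Types (phi : R * R -> R).

Lemma cvg_profile_integral (W : R -> R -> R) (W0 g : R -> R) (B M : R) (C : set R) :
  (forall e, 0 < e -> bounded_measurable (W e)) ->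
  (forall e xi, 0 < e -> `|W e xi| <= B) ->
  bounded_measurable W0 -> finite_set C ->
  (forall xi, ~ C xi -> W e xi @[e --> 0^'+] --> W0 xi) ->
  continuous g -> (forall xi, M <= `|xi| -> g xi = 0) ->
  \int[leb]_xi (W e xi * g xi) @[e --> 0^'+] --> \int[leb]_xi (W0 xi * g xi).
Proof.
move=> bW WB bW0 fC Wcvg cg gs; apply/cvg_at_rightP => u [u0 ucvg].
have iW (V : R -> R) : bounded_measurable V ->
    leb.-integrable setT (EFin \o (fun x => V x * g x)).
  by move=> bV; exact: integrable_bounded_compact bV cg gs.
have mg : measurable_fun setT (g : measurableTypeR R -> measurableTypeR R).
  exact: continuous_measurable_fun.
have iB := iW _ (bm_cst B).
have [] := @dominated_convergence _ _ _ leb setT measurableT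
  (fun n xi => (W (u n) xi * g xi)%:E) (fun xi => (W0 xi * g xi)%:E)
  (fun xi => `|(B * g xi)%:E|%E).
- by move=> n; exact: measurable_int (iW _ (bW _ (u0 n))).
- exact: measurable_int (iW _ bW0).
- exists C; split.
  + by apply: countable_measurable; [move=> t; exact: measurable_set1|exact: finite_set_countable].
  + by apply: countable_lebesgue_measure0; exact: finite_set_countable.
  + move=> xi /= nx; apply: contrapT => /Wcvg Wxi; apply: nx => _.
    apply: cvg_EFin; first exact: nearW.
    rewrite /comp/=; apply: cvgM; last exact: cvg_cst.
    by move/cvg_at_rightP : Wxi => /(_ u); apply.
- exact: integrable_abse.
- apply: aeW => xi n _; rewrite lee_fin !normrM ler_wpM2r//.
  by rewrite (le_trans (WB _ _ (u0 n)))// ler_norm.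
- move=> _ _ lim; rewrite /Rintegral; apply: fine_cvg.
  rewrite fineK//; apply: integrable_fin_num => //; exact: iW.
Qed.

Lemma regular_distr_off2 (a b : R) (W V : R -> R) (f : R * R -> R) phi :
  test_function phi -> bounded_measurable V ->
  (forall x, x != a -> x != b -> W x = V x) -> selfsimilar W f ->
  regular_distr f phi = \int[leb]_xi (V xi * ray id phi xi).
Proof.
move=> tphi bV WV fW; have bW := bm_off2 bV WV.
have [M0 _ /(_ _ (lexx _)) pr] := test_profile tphi.
rewrite (regular_distr_ray tphi bW fW); apply: (@Rintegral_off2 _ a b).
- exact: integrable_bounded_compact bW (mass_continuous pr) (mass_support pr).
- exact: integrable_bounded_compact bV (mass_continuous pr) (mass_support pr).
- by move=> x xa xb; rewrite WV.
Qed.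

Lemma weighted_delta_linear (k s : R) phi : test_function phi ->
  weighted_delta (fun t => k * t) (fun t => s * t) phi = k * ray id phi s.
Proof.
move=> tphi; have [A [c [d [c0 cd bp _ _]]]] := test_function_box tphi.
rewrite -[LHS]/(ray (fun t => k * t) phi s) !(boxed_segment _ _ c0 bp).
have [cf _] := bp.
rewrite -RintegralZl//; last first.
  by apply: integrable_along_ray => // t; exact: cvg_id.
by apply: eq_Rintegral => t _; rewrite mulrA.
Qed.

Section Rarefaction.
Variables (ul ur rl rr : R).
Hypothesis (lr : ul <= ur).

Definition vacuum_profile (xi : R) : R :=
  if xi < ul then rl else if xi < ur then 0 else rr.

Lemma fan_U_cvg xi : fan_U e ul ur xi @[e --> 0^'+] --> clamp ul ur xi.
Proof.
apply/cvgrPdist_le => d d0; near=> e.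
rewrite /fan_U (le_trans (clamp_dist _ _ lr))// opprB addrC subrK.
have e0 : 0 < e by near: e; exact: nbhs_right_gt.
by rewrite gtr0_norm//; near: e; exact: nbhs_right_ltW.
Unshelve. all: by end_near. Qed.

(** Strictly inside ]ul, ur[ the velocity stays below xi < ur, so the density is
    at most |rr| exp(- (ur - xi) / e), which is bounded by |rr| e / (ur - xi). *)
Lemma fan_P_cvg xi : xi != ur ->
  fan_P e ul ur rl rr xi @[e --> 0^'+] --> vacuum_profile xi.
Proof.
move=> xur; rewrite /vacuum_profile; have [xl|lx] := ltP xi ul.
  by apply: cvg_near_cst; near=> e; rewrite fan_P_left.
have [xr|rx] := ltP xi ur; last first.
  apply: cvg_near_cst; near=> e.
  rewrite fan_P_right// fan_U_right ?subrr ?mul0r ?expR0 ?mulr1//.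
  rewrite -lerBrDl; near: e; apply: nbhs_right_ltW.
  by rewrite subr_gt0 lt_neqAle eq_sym xur.
apply/cvgrPdist_le => d d0; near=> e.
have e0 : 0 < e by near: e; exact: nbhs_right_gt.
rewrite sub0r normrN fan_P_right// normrM [X in _ * X]gtr0_norm ?expR_gt0//.
have y0 : 0 < (ur - xi) / e by rewrite divr_gt0// subr_gt0.
have Ux : fan_U e ul ur xi <= xi.
  rewrite /fan_U /clamp; case: ltP => h1//; case: ltP => h2; lra.
(* Since 1 + y <= exp y, one has exp(- y) <= 1 / y for y > 0. *)
have le1 : expR ((fan_U e ul ur xi - ur) / e) <= ((ur - xi) / e)^-1.
  apply: (@le_trans _ _ (expR (- ((ur - xi) / e)))).
    by rewrite ler_expR -mulNr ler_pM2r ?invr_gt0//; lra.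
  rewrite expRN lef_pV2 ?posrE ?expR_gt0//.
  by rewrite (le_trans _ (expR_ge1Dx _))// lerDr.
rewrite (le_trans (ler_wpM2l _ le1))// invf_div mulrA.
rewrite ler_pdivrMr ?subr_gt0//.
have r0 : 0 < `|rr| + 1 by rewrite ltr_wpDl.
have ee : e <= d * (ur - xi) / (`|rr| + 1).
  by near: e; apply: nbhs_right_ltW; rewrite divr_gt0// mulr_gt0// subr_gt0.
rewrite ler_pdivlMr// in ee; apply: le_trans ee.
by rewrite mulrC ler_pM2l// lerDl.
Unshelve. all: by end_near. Qed.

Lemma bm_clamp : bounded_measurable (clamp ul ur).
Proof.
split; first by apply: continuous_measurable_fun; exact: clamp_continuous.
by exists (`|ul| + `|ur|) => x; exact: clamp_norm.
Qed.

Lemma bm_vacuum : bounded_measurable vacuum_profile.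
Proof. by do 2 (apply: bm_split_lt; first exact: bm_cst); exact: bm_cst. Qed.

Lemma lax_solutions_cvg (u rho : R -> R * R -> R) phi : test_function phi ->
  (forall eps : R, 0 < eps ->
    lax_riemann_solution eps (ul, rl) (ur, rr) (u eps) (rho eps)) ->
  regular_distr (u eps) phi @[eps --> 0^'+] -->
    \int[leb]_xi (clamp ul ur xi * ray id phi xi) /\
  regular_distr (rho eps) phi @[eps --> 0^'+] -->
    \int[leb]_xi (vacuum_profile xi * ray id phi xi).
Proof.
move=> tphi lax; have [M0 _ /(_ _ (lexx _)) pr] := test_profile tphi.
have canon (e : R) : 0 < e ->
    regular_distr (u e) phi = \int[leb]_xi (fan_U e ul ur xi * ray id phi xi) /\
    regular_distr (rho e) phi =
      \int[leb]_xi (fan_P e ul ur rl rr xi * ray id phi xi).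
  move=> e0; have [_ _ _ [U [P [/(lax_fan_unique e0 lr)[a UP] S]]]] := lax e e0.
  split.
    apply: (@regular_distr_off2 ul a U) => //; first exact: bm_fan_U.
      by move=> x xl xa; have [] := UP x xl xa.
    by move=> p /S[].
  apply: (@regular_distr_off2 ul a P) => //; first exact: bm_fan_P.
    by move=> x xl xa; have [] := UP x xl xa.
  by move=> p /S[].
split.
- apply: (@cvg_trans _ (\int[leb]_xi (fan_U e ul ur xi * ray id phi xi) @[e --> 0^'+])).
    apply: near_eq_cvg; near=> e; apply/esym/(canon e _).1.
    by near: e; exact: nbhs_right_gt.
  apply: (@cvg_profile_integral _ _ _ (`|ul| + `|ur|) M0 set0) => //.
  + by move=> e e0; exact: bm_fan_U.
  + by move=> e xi _; exact: clamp_norm.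
  + exact: bm_clamp.
  + by move=> xi _; exact: fan_U_cvg.
  + exact: mass_continuous pr.
  + exact: mass_support pr.
- apply: (@cvg_trans _ (\int[leb]_xi (fan_P e ul ur rl rr xi * ray id phi xi) @[e --> 0^'+])).
    apply: near_eq_cvg; near=> e; apply/esym/(canon e _).2.
    by near: e; exact: nbhs_right_gt.
  apply: (@cvg_profile_integral _ _ _ (`|rl| + `|rr|) M0 [set ur]) => //.
  + by move=> e e0; exact: bm_fan_P.
  + by move=> e xi e0; exact: fan_P_bound.
  + exact: bm_vacuum.
  + by move=> xi xur; apply: fan_P_cvg; apply/eqP.
  + exact: mass_continuous pr.
  + exact: mass_support pr.
Unshelve. all: by end_near. Qed.

End Rarefaction.

Lemma step_cvg (s0 a b c c' : R) phi : test_function phi ->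
  \int[leb]_xi (step_profile (s0 + e) a c' b xi * ray id phi xi) @[e --> 0^'+] -->
  \int[leb]_xi (step_profile s0 a c b xi * ray id phi xi).
Proof.
move=> tphi; have [M0 _ /(_ _ (lexx _)) pr] := test_profile tphi.
apply: (@cvg_profile_integral _ _ _ (`|a| + `|b| + `|c'|) M0 [set s0]) => //.
- by move=> e e0; exact: bm_step.
- move=> e xi e0; rewrite /step_profile.
  have := normr_ge0 a; have := normr_ge0 b; have := normr_ge0 c'.
  by case: ifP => _; [|case: ifP => _]; lra.
- exact: bm_step.
- move=> xi /eqP xs; rewrite /step_profile (negbTE xs).
  have [xs0|s0x] := ltP xi s0.
    apply: cvg_near_cst; near=> e; rewrite ifT//.
    by rewrite (lt_trans xs0)// ltrDl; near: e; exact: nbhs_right_gt.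
  apply: cvg_near_cst; near=> e.
  have h : s0 + e < xi.
    rewrite -ltrBrDl; near: e; apply: nbhs_right_lt.
    by rewrite subr_gt0 lt_neqAle eq_sym xs.
  by rewrite ltNge (ltW h)/= gt_eqF.
- exact: mass_continuous pr.
- exact: mass_support pr.
Unshelve. all: by end_near. Qed.

End Convergence.

(** * Smooth functions with compact support *)

Section Bumps.
Context {R : realType}.

(** The n-th derivative of exp(- 1 / x) on x > 0 is flat_poly n, evaluated at
    1 / x, times exp(- 1 / x). *)
Fixpoint flat_poly (n : nat) : {poly R} :=
  if n is n'.+1 then 'X^2 * (flat_poly n' - (flat_poly n')^`()) else 1.

Definition flat (n : nat) (x : R) : R :=
  if 0 < x then (flat_poly n).[x^-1] * expR (- x^-1) else 0.

Lemma poly_expR_bounded (p : {poly R}) :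
  exists2 C, 0 <= C & forall y, 0 < y -> `|p.[y] * expR (- y)| <= C.
Proof.
exists (\sum_(i < size p) `|p`_i| * i`!%:R).
  by apply: sumr_ge0 => i _; rewrite mulr_ge0.
move=> y y0; rewrite horner_coef mulr_suml (le_trans (ler_norm_sum _ _ _))//.
apply: ler_sum => i _; rewrite !normrM -mulrA ler_wpM2l//.
rewrite [`|expR _|]gtr0_norm ?expR_gt0// normrX gtr0_norm// expRN.
rewrite ler_pdivrMr ?expR_gt0// mulrC -ler_pdivrMr ?ltr0n ?fact_gt0//.
case: (nat_of_ord i) => [|n]; first by rewrite expr0 divr1 -expR0 ler_expR ltW.
by apply: le_trans (expR_ge1Dxn n (ltW y0)); rewrite lerDr.
Qed.

Lemma flat0 n (x : R) : x <= 0 -> flat n x = 0.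
Proof. by rewrite /flat leNgt => /negbTE ->. Qed.

Lemma flat_gt0 x : 0 < x -> 0 < flat 0 x.
Proof. by rewrite /flat => ->; rewrite hornerC mul1r expR_gt0. Qed.

(** At x = 0 the difference quotient is h q(1 / h) exp(- 1 / h) for the
    polynomial q = X^2 p, hence O(h), as q(y) exp(- y) is bounded for y > 0. *)
Lemma is_derive_flat n (x : R) : is_derive x 1 (flat n) (flat n.+1 x).
Proof.
have [x0|x0|->] := ltgtP x 0.
- have -> : flat n.+1 x = 0 by rewrite flat0// ltW.
  apply: (@near_eq_is_derive _ _ _ (cst 0)).
    by near=> y; rewrite flat0//; apply: ltW; near: y; exact: lt_nbhsl.
- set p := flat_poly n.
  suff d : is_derive x 1 (fun y : R => p.[y^-1] * expR (- y^-1)) (flat n.+1 x).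
    apply: near_eq_is_derive d.
    by near=> y; rewrite /flat ifT//; near: y; exact: lt_nbhsr.
  have xN0 : x != 0 by rewrite gt_eqF.
  have dV : is_derive x 1 (fun y : R => y^-1) (- x ^- 2).
    have := @is_deriveV R (@id R) x 1 1 xN0 (is_derive_id _ _).
    by rewrite /GRing.scale/= mulr1.
  have dp : is_derive (x^-1) 1 (horner p) p^`().[x^-1].
    by rewrite derivE derive1E; apply: derivableP; exact: derivable_horner.
  have d1 := @is_derive1_comp _ (horner p) (fun y : R => y^-1) x _ _ dp dV.
  have dNV : is_derive x 1 (fun y : R => - y^-1) (x ^- 2).
    by have := is_deriveN dV; rewrite opprK.
  have d2 := @is_derive1_comp _ expR _ x _ _ (is_derive_expR _) dNV.
  apply: (@is_derive_eq _ _ _ _ _ _ _ _ (is_deriveM d1 d2)).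
  rewrite /flat x0/= -/p hornerM hornerXn hornerD hornerN /GRing.scale/=.
  by rewrite exprVn; ring.
- have -> : flat n.+1 0 = 0 by rewrite flat0.
  have [C C0 CP] := poly_expR_bounded ('X^2 * flat_poly n).
  have lim : h^-1 *: (flat n (h *: 1 + 0) - flat n 0) @[h --> 0^'] --> (0 : R).
    have C1 : 0 < C + 1 by rewrite ltr_wpDl.
    apply/cvgrPdist_le => e e0; have eC : 0 < e / (C + 1) by rewrite divr_gt0.
    near=> h.
    rewrite sub0r normrN [flat n 0]flat0// subr0 addr0 /GRing.scale/= mulr1.
    have [h0|h0] := leP h 0; first by rewrite flat0// mulr0 normr0 ltW.
    rewrite /flat h0.
    have -> : h^-1 * ((flat_poly n).[h^-1] * expR (- h^-1)) =
       h * (('X^2 * flat_poly n).[h^-1] * expR (- h^-1)).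
      rewrite hornerM hornerXn; field; exact: lt0r_neq0.
    rewrite normrM (le_trans (ler_wpM2l _ (CP _ _)))// ?invr_gt0//.
    have : `|h| <= e / (C + 1).
      by apply: ltW; near: h; exact: dnbhs0_lt.
    rewrite ler_pdivlMr//; apply: le_trans.
    by rewrite ler_wpM2l// lerDl.
  split; first by apply/cvg_ex; exists 0.
  exact: cvg_lim.
Unshelve. all: by end_near. Qed.

(** A class of smooth functions of the plane that contains the required test
    functions and is visibly stable under directional derivatives; smoothness
    follows by induction on the order. *)
Inductive flat_algebra : (R * R -> R) -> Prop :=
| FlatCst k : flat_algebra (fun=> k)
| FlatAffine n a b c : flat_algebra (fun p => flat n (a * p.1 + b * p.2 + c))
| FlatAdd f g : flat_algebra f -> flat_algebra g ->
    flat_algebra (fun p => f p + g p)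
| FlatMul f g : flat_algebra f -> flat_algebra g ->
    flat_algebra (fun p => f p * g p).

Lemma is_derive_along_line (f : R * R -> R) (p v : R * R) (df : R) :
  is_derive (0 : R) 1 (fun h : R => f (h *: v + p)) df -> is_derive p v f df.
Proof.
move=> [ex val].
have E : (fun h : R => h^-1 *: (f ((h *: 1 + 0) *: v + p) - f (0 *: v + p))) =
         (fun h : R => h^-1 *: (f (h *: v + p) - f p)).
  by apply/funext => h; rewrite addr0 scale0r add0r [h *: 1]mulr1.
split; first by move: ex; rewrite /derivable E.
by rewrite -val /derive E.
Qed.

Lemma flat_algebra_derive f v : flat_algebra f ->
  exists2 g, flat_algebra g & forall p, is_derive p v f (g p).
Proof.
elim=> [k|n a b c|f1 f2 _ [g1 G1 d1] _ [g2 G2 d2]|f1 f2 F1 [g1 G1 d1] F2 [g2 G2 d2]].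
- by exists (fun=> 0); [exact: FlatCst|move=> p; exact: is_derive_cst].
- exists (fun p => (a * v.1 + b * v.2) * flat n.+1 (a * p.1 + b * p.2 + c)).
    by apply: FlatMul; [exact: FlatCst|exact: FlatAffine].
  move=> p; apply: is_derive_along_line.
  set k := a * v.1 + b * v.2; set L := a * p.1 + b * p.2 + c.
  have -> : (fun h : R => flat n (a * (h *: v + p).1 + b * (h *: v + p).2 + c)) =
      flat n \o (fun h => L - h * (- k)).
    by apply/funext => h; rewrite /= /L /k /GRing.scale/=; congr (flat n _); ring.
  have dL := is_derive_affine L (- k) 0; rewrite opprK in dL.
  have dF := is_derive_flat n (L - 0 * (- k)).
  have d := @is_derive1_comp _ (flat n) (fun h => L - h * (- k)) 0 _ _ dF dL.
  apply: (@is_derive_eq _ _ _ _ _ _ _ _ d).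
  by rewrite mul0r subr0 mulrC.
- exists (fun p => g1 p + g2 p); first exact: FlatAdd.
  by move=> p; apply: is_deriveD.
- exists (fun p => f1 p * g2 p + f2 p * g1 p).
    by apply: FlatAdd; exact: FlatMul.
  by move=> p; apply: is_deriveM.
Qed.

Lemma flat_algebra_continuous f : flat_algebra f -> continuous f.
Proof.
elim=> [k|n a b c|f1 f2 _ c1 _ c2|f1 f2 _ c1 _ c2].
- by move=> p; exact: cst_continuous.
- move=> p; apply: (@continuous_comp _ _ _ (fun p : R * R => a * p.1 + b * p.2 + c)).
    apply: cvgD; last exact: cvg_cst.
    apply: cvgD; (apply: cvgM; first exact: cvg_cst).
      exact: continuous_fst_plane.
    exact: continuous_snd_plane.
  exact: is_derive_continuous (is_derive_flat n) _.
- by move=> p; apply: cvgD; [exact: c1|exact: c2].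
- by move=> p; apply: cvgM; [exact: c1|exact: c2].
Qed.

Lemma flat_algebra_smooth f : flat_algebra f -> smooth f.
Proof.
move=> Ff k; elim: k f Ff => [|k IH] f Ff; split => //; try exact: flat_algebra_continuous.
have [g Fg dg] := flat_algebra_derive (1, 0) Ff.
have [g' Fg' dg'] := flat_algebra_derive (0, 1) Ff.
split.
- by move=> p; have [] := dg p.
- by move=> p; have [] := dg' p.
- rewrite (_ : Dx f = g); first exact: IH.
  by apply/funext => p; have := @derive_val _ _ _ _ _ _ _ (dg p).
- rewrite (_ : Dt f = g'); first exact: IH.
  by apply/funext => p; have := @derive_val _ _ _ _ _ _ _ (dg' p).
Qed.

End Bumps.

(** * A test function concentrated near a line *)

Section LineCutoff.
Context {R : realType}.
Notation leb := (@lebesgue_measure R).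

Lemma supp_subset (f : R * R -> R) (S : set (R * R)) : closed S ->
  (forall p, f p != 0 -> S p) -> supp f `<=` S.
Proof. by move=> /closure_id cS fS; rewrite cS; apply: closure_subset => p /fS. Qed.

Lemma test_Dx (phi : R * R -> R) : test_function phi -> test_function (Dx phi).
Proof.
move=> [sphi cs sub]; have ss : supp (Dx phi) `<=` supp phi.
  by apply: supp_subset; [exact: closed_closure|move=> p; exact: supp_derive].
split.
- by move=> k; have [_ []] := sphi k.+1.
- by apply: subclosed_compact cs ss; exact: closed_closure.
- by move=> p /ss /sub.
Qed.

Lemma test_Dt (phi : R * R -> R) : test_function phi -> test_function (Dt phi).
Proof.
move=> [sphi cs sub]; have ss : supp (Dt phi) `<=` supp phi.
  by apply: supp_subset; [exact: closed_closure|move=> p; exact: supp_derive].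
split.
- by move=> k; have [_ []] := sphi k.+1.
- by apply: subclosed_compact cs ss; exact: closed_closure.
- by move=> p /ss /sub.
Qed.

Definition cutoff (a b t : R) : R := flat 0 (t - a) * flat 0 (b - t).
Definition cutoff' (a b t : R) : R :=
  flat 1 (t - a) * flat 0 (b - t) - flat 0 (t - a) * flat 1 (b - t).

Lemma is_derive_cutoff a b (t : R) : is_derive t 1 (cutoff a b) (cutoff' a b t).
Proof.
have d1 : is_derive t 1 (fun t => flat 0 (t - a)) (flat 1 (t - a)).
  have dL := is_derive_affine (- a) (-1) t.
  rewrite opprK in dL.
  have d := @is_derive1_comp _ (flat 0) (fun t => - a - t * -1) t _ _ (is_derive_flat _ _) dL.
  have -> : (fun t => flat 0 (t - a)) = flat 0 \o (fun t => - a - t * -1).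
    by apply/funext => y /=; rewrite mulrN1 opprK addrC.
  apply: (@is_derive_eq _ _ _ _ _ _ _ _ d).
  by rewrite mulr1 mulrN1 opprK addrC.
have d2 : is_derive t 1 (fun t => flat 0 (b - t)) (- flat 1 (b - t)).
  have dL := is_derive_affine b 1 t.
  have d := @is_derive1_comp _ (flat 0) (fun t => b - t * 1) t _ _ (is_derive_flat _ _) dL.
  have -> : (fun t => flat 0 (b - t)) = flat 0 \o (fun t => b - t * 1).
    by apply/funext => y /=; rewrite mulr1.
  apply: (@is_derive_eq _ _ _ _ _ _ _ _ d).
  by rewrite mulr1 mulrN1.
have d := is_deriveM d1 d2.
by apply: (@is_derive_eq _ _ _ _ _ _ _ _ d); rewrite /cutoff' /GRing.scale/=; ring.
Qed.

Lemma cutoff_continuous a b : continuous (cutoff a b).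
Proof. exact: is_derive_continuous (is_derive_cutoff a b). Qed.

Lemma cutoff'_continuous a b : continuous (cutoff' a b).
Proof.
have cf n : continuous (flat n : R -> R).
  exact: is_derive_continuous (is_derive_flat n).
have cl n : continuous (fun t : R => flat n (t - a)).
  move=> t; apply: (@continuous_comp _ _ _ (fun t => t - a) (flat n)); last exact: cf.
  by apply: cvgB; [exact: cvg_id|exact: cvg_cst].
have cr n : continuous (fun t : R => flat n (b - t)).
  move=> t; apply: (@continuous_comp _ _ _ (fun t => b - t) (flat n)); last exact: cf.
  by apply: cvgB; [exact: cvg_cst|exact: cvg_id].
by move=> t; apply: cvgB; apply: cvgM; [exact: cl|exact: cr|exact: cl|exact: cr].
Qed.

Lemma cutoff_out a b t : t <= a \/ b <= t -> cutoff a b t = 0.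
Proof.
rewrite /cutoff => -[h|h]; first by rewrite (flat0 0%N) ?mul0r ?subr_le0.
by rewrite mulrC (flat0 0%N) ?mul0r ?subr_le0.
Qed.

Lemma cutoff'_out a b t : t <= a \/ b <= t -> cutoff' a b t = 0.
Proof.
have f0 n x : x <= 0 -> flat n x = 0 :> R by exact: flat0.
rewrite /cutoff' => -[h|h].
  by rewrite (f0 1%N (t - a)) ?subr_le0// (f0 0%N (t - a)) ?subr_le0// !mul0r subr0.
by rewrite (f0 1%N (b - t)) ?subr_le0// (f0 0%N (b - t)) ?subr_le0// !mulr0 subr0.
Qed.

Lemma cutoff_gt0 a b t : a < t < b -> 0 < cutoff a b t.
Proof. by move=> /andP[h1 h2]; rewrite mulr_gt0// flat_gt0// subr_gt0. Qed.

Lemma cutoff_ge0 a b t : 0 <= cutoff a b t.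
Proof.
have [h1|h1] := leP t a; first by rewrite cutoff_out//; left.
have [h2|h2] := leP b t; first by rewrite cutoff_out//; right.
by rewrite ltW// cutoff_gt0// h1.
Qed.

Lemma cutoff_integral_gt0 a b : a < b -> 0 < \int[leb]_(t in `[a, b]) cutoff a b t.
Proof.
move=> ab.
(* On the middle third of [a, b] the function has a positive minimum. *)
pose c := a + (b - a) / 3; pose d := b - (b - a) / 3.
have [ac cd db] : [/\ a < c, c < d & d < b] by rewrite /c /d; split; lra.
have [m mcd mP] := @EVT_min R (cutoff a b) c d (ltW cd)
  (continuous_subspaceT (@cutoff_continuous a b)).
have m0 : 0 < cutoff a b m.
  move: mcd; rewrite in_itv/= => /andP[h1 h2].
  by apply: cutoff_gt0; apply/andP; split; lra.
have ib x y : leb.-integrable `[x, y] (EFin \o cutoff a b).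
  by apply: continuous_integrable_segment; exact: cutoff_continuous.
have split3 : \int[leb]_(t in `[a, b]) cutoff a b t =
    \int[leb]_(t in `[a, c]) cutoff a b t + (\int[leb]_(t in `[c, d]) cutoff a b t +
    \int[leb]_(t in `[d, b]) cutoff a b t).
  have iT : leb.-integrable setT (EFin \o cutoff a b).
    have bs t : cutoff a b t != 0 -> [set` `[a, b]] t.
      move=> h; rewrite /= in_itv/=; apply/andP; split; rewrite leNgt;
        apply: contraNN h => /ltW h; rewrite cutoff_out//; [by left|by right].
    rewrite -(patch_support bs) -restrict_EFin.
    have mI : measurable ([set` `[a, b]] : set (measurableTypeR R)) by [].
    by apply/(integrable_mkcond _ mI); exact: ib.
  by rewrite (Rintegral_chain (ltW ac) (ltW (lt_trans cd db)) iT)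
     (Rintegral_chain (ltW cd) (ltW db) iT).
rewrite split3.
apply: ltr_wpDl; first by apply: Rintegral_ge0 => t _; exact: cutoff_ge0.
apply: ltr_pwDl; last by apply: Rintegral_ge0 => t _; exact: cutoff_ge0.
apply: (@lt_le_trans _ _ (\int[leb]_(t in `[c, d]) cutoff a b m)).
  rewrite Rintegral_cst//.
  have -> : fine (leb `[c, d]) = d - c.
    by rewrite lebesgue_measure_itv/= lte_fin cd.
  by rewrite mulr_gt0// subr_gt0.
apply: le_Rintegral => //.
  apply: (@continuous_integrable_segment _ (fun=> cutoff a b m)) => t.
  exact: cst_continuous.
Qed.

(** The first factor is even in x - s t, so that the derivative in x vanishes on
    the line x = s t; there the derivative in t is that of the trace. *)
Definition line_cutoff (s a b : R) (p : R * R) : R :=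
  cutoff (- 1) 1 (p.1 - s * p.2) * cutoff a b p.2.

Variables (s a b : R).
Hypothesis (a0 : 0 < a).

Lemma line_cutoff_test : test_function (line_cutoff s a b).
Proof.
pose K : set (R * R) := [set` `[- (1 + `|s| * `|b|), 1 + `|s| * `|b|]] `*` [set` `[a, b]].
have cK : compact K by apply: compact_setX; exact: segment_compact.
have sK : supp (line_cutoff s a b) `<=` K.
  apply: supp_subset; first by apply: compact_closed => //; exact: norm_hausdorff.
  move=> [x t]; rewrite /line_cutoff/= mulf_eq0 negb_or => /andP[h1 h2].
  have {h2}[at_ tb] : a < t /\ t < b.
    split; rewrite ltNge; apply: contraNN h2 => h; rewrite cutoff_out//; [by left|by right].
  have {h1}[h1 h2] : - 1 < x - s * t /\ x - s * t < 1.
    split; rewrite ltNge; apply: contraNN h1 => h; rewrite cutoff_out//; [by left|by right].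
  have h3 : `|s * t| <= `|s| * `|b|.
    rewrite normrM ler_wpM2l// gtr0_norm; last exact: lt_trans at_.
    by rewrite (le_trans (ltW tb))// ler_norm.
  have := ler_norm (s * t); have := ler_norm (- (s * t)); rewrite normrN => h4 h5.
  split; rewrite /= in_itv/=; last by rewrite !ltW.
  by apply/andP; split; lra.
split.
- apply: flat_algebra_smooth.
  have -> : line_cutoff s a b = fun p =>
     (flat 0 (1 * p.1 + (- s) * p.2 + 1) * flat 0 ((-1) * p.1 + s * p.2 + 1)) *
     (flat 0 (0 * p.1 + 1 * p.2 + (- a)) * flat 0 (0 * p.1 + (-1) * p.2 + b)).
    apply/funext => p; rewrite /line_cutoff /cutoff.
    have -> : 1 * p.1 + (- s) * p.2 + 1 = p.1 - s * p.2 - -1 by ring.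
    have -> : (-1) * p.1 + s * p.2 + 1 = 1 - (p.1 - s * p.2) by ring.
    have -> : 0 * p.1 + 1 * p.2 + (- a) = p.2 - a by ring.
    by have -> : 0 * p.1 + (-1) * p.2 + b = b - p.2 by ring.
  by apply: FlatMul; apply: FlatMul; exact: FlatAffine.
- by apply: subclosed_compact cK sK; exact: closed_closure.
- by move=> p /sK[_]; rewrite /= in_itv/= => /andP[h _]; exact: lt_le_trans h.
Qed.

Definition peak : R := cutoff (- 1) 1 0.

Lemma peak_gt0 : 0 < peak.
Proof. by apply: cutoff_gt0; rewrite ltrN10 ltr01. Qed.

Lemma line_cutoff_diag t : line_cutoff s a b (s * t, t) = peak * cutoff a b t.
Proof. by rewrite /line_cutoff/= subrr. Qed.

Lemma line_cutoff_Dx t : Dx (line_cutoff s a b) (s * t, t) = 0.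
Proof.
have [smooth_bump _ _] := line_cutoff_test; have [dx _] := smooth_derivable smooth_bump.
have d1 := is_derive_Dx (dx (s * t, t)).
have dL := is_derive_affine (- (s * t)) (-1) (s * t); rewrite opprK in dL.
(* An even function has zero derivative at 0. *)
have dB : is_derive (- (s * t) - s * t * -1) 1 (cutoff (- 1) 1) 0.
  apply: (@is_derive_eq _ _ _ _ _ _ _ _ (is_derive_cutoff _ _ _)).
  rewrite mulrN1 opprK addNr /cutoff' opprK add0r subr0.
  by rewrite mulrC subrr.
have d2 := @is_derive1_comp _ (cutoff (- 1) 1) (fun x => - (s * t) - x * -1) (s * t) _ _ dB dL.
have d3 : is_derive (s * t) 1 (fun x => line_cutoff s a b (x, t)) 0.
  have -> : (fun x => line_cutoff s a b (x, t)) =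
      cutoff a b t \*: (cutoff (- 1) 1 \o (fun x => - (s * t) - x * -1)).
    apply/funext => x; rewrite /line_cutoff/= mulrN1 opprK [_ + x]addrC.
    by rewrite /GRing.scale/= mulrC.
  by apply: is_derive_eq; rewrite mul0r scaler0.
have := @derive_val _ _ _ _ _ _ _ d1; have := @derive_val _ _ _ _ _ _ _ d3.
by move=> -> ->.
Qed.

Lemma line_cutoff_Dt t : Dt (line_cutoff s a b) (s * t, t) = peak * cutoff' a b t.
Proof.
have tl := line_cutoff_test; have [sl _ _] := tl.
have [dx dt] := smooth_derivable sl.
have [sx _ _] := test_Dx tl.
have cx : continuous (Dx (line_cutoff s a b)) by have [] := sx 0%N.
have d1 := is_derive_ray s t dx dt cx.
rewrite line_cutoff_Dx mulr0 add0r in d1.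
have d2 : is_derive t 1 (fun t => line_cutoff s a b (s * t, t)) (peak * cutoff' a b t).
  have -> : (fun t => line_cutoff s a b (s * t, t)) = peak \*: cutoff a b.
    by apply/funext => y; rewrite line_cutoff_diag.
  by have := is_derive_cutoff a b t => db; apply: is_derive_eq.
have := @derive_val _ _ _ _ _ _ _ d1; have := @derive_val _ _ _ _ _ _ _ d2.
by move=> -> ->.
Qed.

Lemma ray_line_cutoff : ray (cst 1) (line_cutoff s a b) s =
  peak * \int[leb]_(t in `[a, b]) cutoff a b t.
Proof.
rewrite -RintegralZl//; last first.
  by apply: continuous_integrable_segment; exact: cutoff_continuous.
rewrite /ray /weighted_delta.
have E t : cst 1 t * line_cutoff s a b (s * t, t) = peak * cutoff a b t.
  by rewrite line_cutoff_diag mul1r.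
under eq_Rintegral do rewrite E.
have supp_ t : peak * cutoff a b t != 0 -> a < t < b.
  rewrite mulf_eq0 negb_or => /andP[_ h].
  apply/andP; split; rewrite ltNge; apply: contraNN h => h; rewrite cutoff_out//; [by left|by right].
rewrite (@Rintegral_support _ _ _ leb [set` `]0, +oo[]%R); last first.
  by move=> t /supp_ /andP[h _]; rewrite /= in_itv/= andbT; exact: lt_trans h.
rewrite (@Rintegral_support _ _ _ leb [set` `[a, b]])// => t /supp_ /andP[h1 h2].
by rewrite /= in_itv/= !ltW.
Qed.

End LineCutoff.

(** * Recovering the mass of a delta wave *)

Section DeltaWaves.
Context {R : realType}.
Notation leb := (@lebesgue_measure R).

Lemma near_segment (x : R) (A : set R) : nbhs x A ->
  exists a b, [/\ a < x, x < b & forall y, a <= y <= b -> A y].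
Proof.
move=> /nbhs_ballP[r /= r0 rA]; exists (x - r / 2), (x + r / 2).
split; [lra|lra|] => y yab; apply: rA; rewrite /ball/= distrC ltr_norml.
by move: yab r0; lra.
Qed.

Lemma continuous_gt0 (f : R -> R) : {within `[0, +oo[, continuous f} ->
  forall t : R, 0 < t -> {for t, continuous f}.
Proof.
move=> cf t t0.
have : {within `]0, +oo[, continuous f}.
  by apply: continuous_subspaceW cf => x; rewrite /= !in_itv/= !andbT => /ltW.
rewrite continuous_open_subspace; last exact: interval_open.
by apply; rewrite inE/= in_itv/= t0.
Qed.

(** The fundamental lemma of the calculus of variations, for the functions cutoff
    only: if g t > 0, then g is bounded below by g t / 2 around t. *)
Lemma cutoff_test_eq0 (g : R -> R) :
  (forall t, 0 < t -> {for t, continuous g}) ->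
  (forall a b, 0 < a -> a < b -> \int[leb]_(t in `[a, b]) (g t * cutoff a b t) = 0) ->
  forall t, 0 < t -> g t = 0.
Proof.
move=> cg gint t t0; apply: contrapT => /eqP gt.
wlog gt0 : g cg gint gt / 0 < g t.
  move=> W; have [|gneg] := ltP 0 (g t); first exact: W.
  apply: (W (fun s => - g s)).
  - by move=> s s0; apply: cvgN; exact: cg.
  - move=> a b a0 ab.
    under eq_Rintegral do rewrite mulNr -mulN1r.
    have i1 : leb.-integrable `[a, b] (EFin \o (fun t => g t * cutoff a b t)).
      apply: continuous_compact_integrable; first exact: segment_compact.
      apply: continuous_in_subspaceT => s /set_mem; rewrite /= in_itv/= => /andP[sa _].
      by apply: cvgM; [apply: cg; exact: lt_le_trans sa|exact: cutoff_continuous].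
    by rewrite RintegralZl// gint// mulr0.
  - by rewrite oppr_eq0.
  - by rewrite oppr_gt0 lt_neqAle gt.
have near_ : nbhs t [set s | g t / 2 < g s /\ 0 < s].
  have h1 : \forall s \near t, g t / 2 < g s.
    have half : g t / 2 < g t by lra.
    exact: (@cvgr_gt _ _ _ _ g (g t) (cg t t0) _ half).
  by near=> s; split; near: s; [exact: h1|exact: lt_nbhsr].
have [a [b [at_ tb abP]]] := near_segment near_.
have ab : a < b by exact: lt_trans tb.
have [|_ a0] := abP a; first by rewrite lexx ltW.
have : g t / 2 * \int[leb]_(s in `[a, b]) cutoff a b s <=
    \int[leb]_(s in `[a, b]) (g s * cutoff a b s).
  have ib : leb.-integrable `[a, b] (EFin \o cutoff a b).
    by apply: continuous_integrable_segment; exact: cutoff_continuous.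
  rewrite -RintegralZl//; apply: le_Rintegral => //.
  - apply: (@continuous_integrable_segment _ (fun s => g t / 2 * cutoff a b s)) => s.
    by apply: cvgM; [exact: cvg_cst|exact: cutoff_continuous].
  - apply: continuous_compact_integrable; first exact: segment_compact.
    apply: continuous_in_subspaceT => s /set_mem; rewrite /= in_itv/= => /andP[sa _].
    by apply: cvgM; [apply: cg; exact: lt_le_trans sa|exact: cutoff_continuous].
  - move=> s; rewrite /= in_itv/= => /abP[gs _].
    by rewrite ler_wpM2r ?cutoff_ge0// ltW.
rewrite gint// leNgt mulr_gt0//; last exact: cutoff_integral_gt0.
by rewrite divr_gt0.
Unshelve. all: by end_near. Qed.

(** Integrating by parts, the hypothesis says that m' - C is orthogonal to all
    the cutoffs. *)
Lemma linear_of_test (m : R -> R) (C : R) :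
  C1_halfline m -> m 0 = 0 ->
  (forall a b, 0 < a -> a < b ->
     \int[leb]_(t in `[a, b]) (m t * cutoff' a b t) =
     - C * \int[leb]_(t in `[a, b]) cutoff a b t) ->
  forall t, 0 <= t -> m t = C * t.
Proof.
move=> [cm [m' [cm' dm]]] m0 mint.
have cm't t : 0 < t -> {for t, continuous m'} by exact: continuous_gt0.
have cmt t : 0 < t -> {for t, continuous m} by exact: continuous_gt0.
have m'E t : 0 < t -> m' t - C = 0.
  apply: (@cutoff_test_eq0 (fun t => m' t - C)) => [s s0|a b a0 ab].
    by apply: cvgB; [exact: cm't|exact: cvg_cst].
  have cin (f : R -> R) : (forall s, 0 < s -> {for s, continuous f}) ->
      {within `[a, b], continuous f}.
    move=> cf; apply: continuous_in_subspaceT => s /set_mem.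
    by rewrite /= in_itv/= => /andP[sa _]; apply: cf; exact: lt_le_trans sa.
  have iin (f : R -> R) : (forall s, 0 < s -> {for s, continuous f}) ->
      leb.-integrable `[a, b] (EFin \o f).
    move=> cf; apply: continuous_compact_integrable; first exact: segment_compact.
    exact: cin.
  have cb' := @cutoff'_continuous R a b.
  have c1 s : 0 < s -> {for s, continuous (fun t => m' t * cutoff a b t)}.
    by move=> s0; apply: cvgM; [exact: cm't|exact: cutoff_continuous].
  have c2 s : 0 < s -> {for s, continuous (fun t => m t * cutoff' a b t)}.
    by move=> s0; apply: cvgM; [exact: cmt|exact: cb'].
  have c3 s : 0 < s -> {for s, continuous (fun t => C * cutoff a b t)}.
    by move=> s0; apply: cvgM; [exact: cvg_cst|exact: cutoff_continuous].
  have ftc : \int[leb]_(t in `[a, b]) (m' t * cutoff a b t + m t * cutoff' a b t) = 0.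
    have dF (s : R) : a < s < b ->
        is_derive s 1 (m * cutoff a b) (m' s * cutoff a b s + m s * cutoff' a b s).
      move=> /andP[sa _]; have s0 := lt_trans a0 sa.
      have d := is_deriveM (dm s s0) (is_derive_cutoff a b s).
      apply: (@is_derive_eq _ _ _ _ _ _ _ _ d).
      by rewrite /GRing.scale/= addrC; congr (_ + _); rewrite mulrC.
    rewrite (FTC_segment (ltW ab) _ _ dF).
    - by rewrite !fctE/= !cutoff_out ?mulr0 ?subr0//; [left|right].
    - by apply: cin => s s0; apply: cvgD; [exact: c1|exact: c2].
    - by apply: cin => s s0; apply: cvgM; [exact: cmt|exact: cutoff_continuous].
  rewrite (RintegralD _ (iin _ c1) (iin _ c2))// mint// in ftc.
  transitivity (\int[leb]_(t in `[a, b]) (m' t * cutoff a b t - C * cutoff a b t)).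
    by apply: eq_Rintegral => s _; rewrite mulrBl.
  rewrite (RintegralB _ (iin _ c1) (iin _ c3))// RintegralZl//.
    by rewrite -ftc mulNr.
  by apply: continuous_integrable_segment; exact: cutoff_continuous.
move=> t; rewrite le_eqVlt => /predU1P[<-|t0]; first by rewrite m0 mulr0.
have [| |c] := @MVT _ m m' 0 t t0.
- by move=> s; rewrite in_itv/= => /andP[s0 _]; exact: dm.
- apply: continuous_subspaceW cm => s; rewrite /= !in_itv/= => /andP[-> _//].
rewrite in_itv/= => /andP[c0 _]; rewrite m0 !subr0 => ->.
by congr (_ * _); apply/eqP; rewrite -subr_eq0; apply/eqP; exact: m'E.
Qed.

End DeltaWaves.

(** * Delta waves *)

Section DeltaWaveSolutions.
Context {R : realType}.
Notation leb := (@lebesgue_measure R).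
Variables (ul ur rl rr : R).
Hypothesis (lt : ur < ul).

(** The Rankine-Hugoniot speed of the first equation. *)
Definition delta_speed (eps : R) : R := (ul + ur) / 2 + eps.
(** The Rankine-Hugoniot deficit of the second equation at speed s, that is, the
    mass that the discontinuity has to absorb per unit of time. *)
Definition delta_rate (s : R) : R := rl * ul - rr * ur - s * (rl - rr).
Definition delta_rho (s : R) : distr :=
  regular_distr (step s rl 0 rr) \+
  weighted_delta (fun t => delta_rate s * t) (fun t => s * t).

Lemma flux_step eps s c : (fun p : R * R => flux_u eps (step s ul c ur p)) =
  step s (flux_u eps ul) (flux_u eps c) (flux_u eps ur).
Proof.
by apply/funext => p; rewrite /step; case: ifP => // _; case: ifP.
Qed.

Lemma regular_distr_eq (f g : R * R -> R) phi :
  (forall p, half_plane p -> f p = g p) -> regular_distr f phi = regular_distr g phi.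
Proof. by move=> fg; apply: eq_Rintegral => p /set_mem hp; rewrite fg. Qed.

Lemma delta_wave_exists eps : exists (u : R * R -> R) (rho : distr),
  delta_wave_solution eps (ul, rl) (ur, rr) u rho.
Proof.
pose s := delta_speed eps; pose k := delta_rate s.
exists (step s ul s ur), (delta_rho s), s, s, (fun t => k * t); split.
  split; [split|by rewrite mulr0|by []|by []].
    by apply: continuous_subspaceT => t; apply: cvgM; [exact: cvg_cst|exact: cvg_id].
  exists (cst k); split; first by apply: continuous_subspaceT => t; exact: cst_continuous.
  move=> t _; have -> : (fun t => k * t) = k \*: id by [].
  by apply: is_derive_eq; rewrite /GRing.scale/= mulr1.
split => phi tphi.
  rewrite flux_step conservation_step//.
  suff -> : flux_u eps ul - flux_u eps ur - s * (ul - ur) = 0 by rewrite mul0r.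
  by rewrite /flux_u /s /delta_speed; field.
have [M0 _ /(_ _ (lexx _)) pr] := test_profile tphi.
rewrite /delta_rho /= addrACA conservation_step//.
have -> : (fun t : R => k * t * s) = (fun t => (k * s) * t).
  by apply/funext => t; rewrite mulrAC.
rewrite (weighted_delta_linear _ _ (test_Dt tphi)).
rewrite (weighted_delta_linear _ _ (test_Dx tphi)) (dt_ray pr).
rewrite -/(delta_rate s) -/k; move: (ray (cst 1) phi s) (ray id (Dx phi) s) => x y.
by rewrite /=; ring.
Qed.

(** Testing the first equation determines s.  In the second equation the test
    function line_cutoff makes the term with the unknown u_delta disappear, and
    what remains determines m. *)
Lemma delta_wave_canonical eps u rho :
  delta_wave_solution eps (ul, rl) (ur, rr) u rho ->
  (exists c, forall p, half_plane p -> u p = step (delta_speed eps) ul c ur p) /\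
  distr_eq rho (delta_rho (delta_speed eps)).
Proof.
move=> [s [c [m [[C1m m0 uE rhoE] [cu crho]]]]]; rewrite /= in uE rhoE crho.
have Dint a b : a < b -> 0 < \int[leb]_(t in `[a, b]) cutoff a b t by exact: cutoff_integral_gt0.
have sE : s = delta_speed eps.
  have l01 : (0 : R) < 1 by [].
  (* Any cutoff on a time interval gives eta(s) > 0, here on [1, 2]. *)
  have tl := @line_cutoff_test R s 1 2 l01.
  have := cu _ tl.
  rewrite (regular_distr_eq _ uE).
  rewrite (@regular_distr_eq (fun p => flux_u eps (u p))
      (step s (flux_u eps ul) (flux_u eps c) (flux_u eps ur))).
    rewrite conservation_step// ray_line_cutoff//.
    move=> /eqP; rewrite mulf_eq0 => /orP[/eqP E|].
      rewrite /delta_speed; apply/eqP; rewrite -subr_eq0.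
      have : (ul - ur) * (s - ((ul + ur) / 2 + eps)) = 0.
        transitivity (- (flux_u eps ul - flux_u eps ur - s * (ul - ur))).
          by rewrite /flux_u; field.
        by rewrite E oppr0.
      have nz : ul - ur != 0 by rewrite subr_eq0 gt_eqF.
      by move/eqP; rewrite mulf_eq0 (negbTE nz).
    by rewrite gt_eqF// mulr_gt0 ?peak_gt0// Dint// ltr1n.
  by move=> p hp; rewrite uE// -[LHS]/((fun p => flux_u eps (step s ul c ur p)) p) flux_step.
have mE : forall t, 0 <= t -> m t = delta_rate s * t.
  apply: linear_of_test => // a b a0 ab.
  have tl := @line_cutoff_test R s a b a0.
  have := crho _ tl; rewrite (rhoE _ (test_Dt tl))/= addrACA conservation_step//.
  rewrite ray_line_cutoff// -/(delta_rate s).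
  have -> : weighted_delta (fun t => m t * c) (fun t => s * t) (Dx (line_cutoff s a b)) = 0.
    rewrite /weighted_delta (eq_Rintegral _ (g := cst 0)).
      by rewrite /Rintegral integral0.
    by move=> t _; rewrite line_cutoff_Dx// mulr0.
  have -> : weighted_delta m (fun t => s * t) (Dt (line_cutoff s a b)) =
      @peak R * \int[leb]_(t in `[a, b]) (m t * cutoff' a b t).
    rewrite -RintegralZl//; last first.
      have [cm _] := C1m.
      apply: continuous_compact_integrable; first exact: segment_compact.
      apply: continuous_in_subspaceT => t /set_mem; rewrite /= in_itv/= => /andP[at_ _].
      have t0 : 0 < t by exact: lt_le_trans at_.
      by apply: cvgM; [exact: continuous_gt0 cm _ t0|exact: cutoff'_continuous].
    have E t : m t * Dt (line_cutoff s a b) (s * t, t) =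
        peak * (m t * cutoff' a b t) by rewrite line_cutoff_Dt// mulrCA.
    have sp t : m t * Dt (line_cutoff s a b) (s * t, t) != 0 -> a <= t <= b.
      rewrite E; apply: contraR; rewrite negb_and -!ltNge => h.
      by rewrite cutoff'_out ?mulr0//; case/orP: h => /ltW; [left|right].
    rewrite /weighted_delta (@Rintegral_support _ _ _ leb [set` `]0, +oo[]%R); last first.
      move=> t /sp /andP[h _]; rewrite /= in_itv/= andbT; exact: lt_le_trans h.
    rewrite -(@Rintegral_support _ _ _ leb [set` `[a, b]]); last exact: sp.
    by apply: eq_Rintegral => t _; exact: E.
  rewrite addr0 => E; have p0 : @peak R != 0 by rewrite gt_eqF// peak_gt0.
  apply: (mulfI p0); move: E; move: (\int[leb]_(t in _) _) (\int[leb]_(t in _) _) => x y.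
  by move=> /eqP; rewrite addrC addr_eq0 => /eqP ->; ring.
rewrite -sE; split; first by exists c.
move=> phi tphi; rewrite rhoE//=; congr (_ + _).
apply: eq_Rintegral => t /set_mem; rewrite /= in_itv/= andbT => t0.
by rewrite mE// ltW.
Qed.

Lemma delta_wave_unique eps u1 u2 rho1 rho2 :
  delta_wave_solution eps (ul, rl) (ur, rr) u1 rho1 ->
  delta_wave_solution eps (ul, rl) (ur, rr) u2 rho2 ->
  ae_eq_half_plane u1 u2 /\ distr_eq rho1 rho2.
Proof.
move=> /delta_wave_canonical[[c1 u1E] r1E] /delta_wave_canonical[[c2 u2E] r2E].
split; last by move=> phi tphi; rewrite r1E// r2E.
apply: (ae_eq_selfsimilar (C := [set delta_speed eps])
  (W1 := step_profile (delta_speed eps) ul c1 ur)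
  (W2 := step_profile (delta_speed eps) ul c2 ur)).
- exact: finite_set1.
- by move=> xi /= /eqP/negbTE h; rewrite /step_profile h.
- by move=> p hp; rewrite u1E// (selfsimilar_step _ _ _ _ hp).
- by move=> p hp; rewrite u2E// (selfsimilar_step _ _ _ _ hp).
Qed.

(** The value of u on the line of discontinuity may be unbounded in eps; off this
    negligible line the steps are uniformly bounded and converge. *)
Lemma delta_waves_cvg (u : R -> R * R -> R) (rho : R -> distr) :
  (forall eps : R, 0 < eps < ul - ur ->
    delta_wave_solution eps (ul, rl) (ur, rr) (u eps) (rho eps)) ->
  distr_cvg (fun eps => regular_distr (u eps)) (regular_distr (delta_limit_u ul ur)) /\
  distr_cvg rho (delta_limit_rho ul ur rl rr).
Proof.
move=> sol.
pose s0 := (ul + ur) / 2.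
have small : \forall e \near 0^'+, 0 < e < ul - ur.
  near=> e; apply/andP; split; near: e; first exact: nbhs_right_gt.
  by apply: nbhs_right_lt; rewrite subr_gt0.
have stepE (s a c b : R) phi : test_function phi -> regular_distr (step s a c b) phi =
    \int[leb]_xi (step_profile s a 0 b xi * ray id phi xi).
  move=> tphi; apply: (@regular_distr_off2 _ s s (step_profile s a c b)) => //.
  - exact: bm_step.
  - by move=> x xs _; rewrite /step_profile (negbTE xs).
  - exact: selfsimilar_step.
split => phi tphi.
- rewrite /delta_limit_u stepE//.
  apply: (@cvg_trans _ (\int[leb]_xi (step_profile (s0 + e) ul 0 ur xi * ray id phi xi)
      @[e --> 0^'+])).
    apply: near_eq_cvg; near=> e; apply: esym.
    have es : 0 < e < ul - ur by near: e.
    have [[c uE] _] := delta_wave_canonical (sol e es).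
    by rewrite (regular_distr_eq _ uE) stepE.
  exact: step_cvg.
- apply: (@cvg_trans _ (\int[leb]_xi (step_profile (s0 + e) rl 0 rr xi * ray id phi xi) +
     delta_rate (s0 + e) * ray id phi (s0 + e) @[e --> 0^'+])).
    apply: near_eq_cvg; near=> e; apply: esym.
    have es : 0 < e < ul - ur by near: e.
    have [_ rE] := delta_wave_canonical (sol e es).
    by rewrite rE// /delta_rho/= stepE// weighted_delta_linear.
  rewrite /delta_limit_rho/= stepE// weighted_delta_linear//.
  apply: cvgD; first exact: step_cvg.
  have [M0 _ /(_ _ (lexx _)) pr] := test_profile tphi.
  have s0cvg : s0 + e @[e --> 0^'+] --> s0.
    rewrite -[X in _ --> X]addr0; apply: cvg_at_right_filter.
    by apply: cvgD; [exact: cvg_cst|exact: cvg_id].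
  apply: cvgM; last first.
    apply: (cvg_comp _ _ s0cvg); exact: mass_continuous pr s0.
  have -> : (ul - ur) * (rl + rr) / 2 = delta_rate s0 by rewrite /delta_rate /s0; field.
  apply: cvgB; first exact: cvg_cst.
  by apply: cvgM; [exact: s0cvg|exact: cvg_cst].
Unshelve. all: by end_near. Qed.

End DeltaWaveSolutions.

(** * Limit distributions and the theorem *)

Section Limits.
Context {R : realType}.
Notation leb := (@lebesgue_measure R).
Variables (ul ur rl rr : R).

Lemma selfsimilar_fan_u : selfsimilar (clamp ul ur) (fan_u ul ur).
Proof.
by move=> p p0; rewrite /fan_u /clamp !ltr_pdivrMr.
Qed.

Lemma selfsimilar_fan_rho :
  selfsimilar (vacuum_profile ul ur rl rr) (fan_rho ul ur rl rr).
Proof.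
by move=> p p0; rewrite /fan_rho /vacuum_profile !ltr_pdivrMr.
Qed.

Lemma lax_cvg_fan (u rho : R -> R * R -> R) : ul <= ur ->
  (forall eps : R, 0 < eps ->
    lax_riemann_solution eps (ul, rl) (ur, rr) (u eps) (rho eps)) ->
  distr_cvg (fun eps => regular_distr (u eps)) (regular_distr (fan_u ul ur)) /\
  distr_cvg (fun eps => regular_distr (rho eps))
            (regular_distr (fan_rho ul ur rl rr)).
Proof.
move=> lr sol; split => phi tphi.
- rewrite (regular_distr_ray tphi (bm_clamp lr) selfsimilar_fan_u).
  exact: (lax_solutions_cvg lr tphi sol).1.
- rewrite (regular_distr_ray tphi (bm_vacuum _ _ _ _) selfsimilar_fan_rho).
  exact: (lax_solutions_cvg lr tphi sol).2.
Qed.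

(** For ul = ur the mass of the limit vanishes and the fan is a single jump, so
    that this case is covered by the convergence of the fan. *)
Lemma delta_limit_diag phi : test_function phi -> ul = ur ->
  regular_distr (delta_limit_u ul ur) phi = regular_distr (fan_u ul ur) phi /\
  delta_limit_rho ul ur rl rr phi = regular_distr (fan_rho ul ur rl rr) phi.
Proof.
move=> tphi E; have mid : (ul + ur) / 2 = ur by rewrite E; field.
have lr : ul <= ur by rewrite E.
split.
- rewrite (regular_distr_ray tphi (bm_clamp lr) selfsimilar_fan_u).
  rewrite /delta_limit_u mid; apply: (@regular_distr_off2 _ ur ur
    (step_profile ur ul ur ur)) => //; first exact: bm_clamp.
    move=> x xr _; rewrite /step_profile /clamp (negbTE xr) E.
    by case: ltP.
  exact: selfsimilar_step.
- rewrite (regular_distr_ray tphi (bm_vacuum _ _ _ _) selfsimilar_fan_rho).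
  rewrite /delta_limit_rho/= mid weighted_delta_linear//.
  rewrite [X in X * (rl + rr)](_ : _ = 0) ?E ?subrr// !mul0r addr0.
  apply: (@regular_distr_off2 _ ur ur (step_profile ur rl 0 rr)) => //.
  + exact: bm_vacuum.
  + move=> x xr _; rewrite /step_profile /vacuum_profile (negbTE xr) ?E.
    by case: ltP.
  + exact: selfsimilar_step.
Qed.

End Limits.

Theorem theorem6p1 (R : realType) (ul ur rhol rhor : R) :
  (ul < ur ->
    (forall eps : R, 0 < eps ->
      (exists u rho : R * R -> R,
        lax_riemann_solution eps (ul, rhol) (ur, rhor) u rho) /\
      (forall u1 rho1 u2 rho2 : R * R -> R,
        lax_riemann_solution eps (ul, rhol) (ur, rhor) u1 rho1 ->
        lax_riemann_solution eps (ul, rhol) (ur, rhor) u2 rho2 ->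
        ae_eq_half_plane u1 u2 /\ ae_eq_half_plane rho1 rho2)) /\
    (forall u rho : R -> R * R -> R,
      (forall eps : R, 0 < eps ->
        lax_riemann_solution eps (ul, rhol) (ur, rhor) (u eps) (rho eps)) ->
      distr_cvg (fun eps => regular_distr (u eps)) (regular_distr (fan_u ul ur)) /\
      distr_cvg (fun eps => regular_distr (rho eps))
                (regular_distr (fan_rho ul ur rhol rhor)))) /\
  (ur <= ul ->
    (ul = ur ->
      (forall eps : R, 0 < eps ->
        (exists u rho : R * R -> R,
          lax_riemann_solution eps (ul, rhol) (ur, rhor) u rho) /\
        (forall u1 rho1 u2 rho2 : R * R -> R,
          lax_riemann_solution eps (ul, rhol) (ur, rhor) u1 rho1 ->
          lax_riemann_solution eps (ul, rhol) (ur, rhor) u2 rho2 ->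
          ae_eq_half_plane u1 u2 /\ ae_eq_half_plane rho1 rho2)) /\
      (forall u rho : R -> R * R -> R,
        (forall eps : R, 0 < eps ->
          lax_riemann_solution eps (ul, rhol) (ur, rhor) (u eps) (rho eps)) ->
        distr_cvg (fun eps => regular_distr (u eps))
                  (regular_distr (delta_limit_u ul ur)) /\
        distr_cvg (fun eps => regular_distr (rho eps))
                  (delta_limit_rho ul ur rhol rhor))) /\
    (ur < ul ->
      (forall eps : R, 0 < eps < ul - ur ->
        (exists (u : R * R -> R) (rho : distr),
          delta_wave_solution eps (ul, rhol) (ur, rhor) u rho) /\
        (forall (u1 u2 : R * R -> R) (rho1 rho2 : distr),
          delta_wave_solution eps (ul, rhol) (ur, rhor) u1 rho1 ->
          delta_wave_solution eps (ul, rhol) (ur, rhor) u2 rho2 ->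
          ae_eq_half_plane u1 u2 /\ distr_eq rho1 rho2)) /\
      (forall (u : R -> R * R -> R) (rho : R -> distr),
        (forall eps : R, 0 < eps < ul - ur ->
          delta_wave_solution eps (ul, rhol) (ur, rhor) (u eps) (rho eps)) ->
        distr_cvg (fun eps => regular_distr (u eps))
                  (regular_distr (delta_limit_u ul ur)) /\
        distr_cvg rho (delta_limit_rho ul ur rhol rhor)))).
Proof.
split=> [lt|le].
  have lr := ltW lt; split; last by move=> u rho; exact: lax_cvg_fan.
  move=> eps e0; split; first exact: lax_riemann_solution_exists.
  by move=> u1 rho1 u2 rho2; exact: lax_riemann_solution_unique.
split=> [E|lt].
  have lr : ul <= ur by rewrite E.
  split=> [eps e0|u rho sol].
    split; first exact: lax_riemann_solution_exists.
    by move=> u1 rho1 u2 rho2; exact: lax_riemann_solution_unique.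
  have [cu crho] := lax_cvg_fan lr sol.
  split=> phi tphi.
    by rewrite (delta_limit_diag rhol rhor tphi E).1; exact: cu.
  by rewrite (delta_limit_diag rhol rhor tphi E).2; exact: crho.
split=> [eps _|u rho].
  split; first exact: delta_wave_exists.
  by move=> u1 u2 rho1 rho2; exact: delta_wave_unique.
exact: delta_waves_cvg.
Qed.
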